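(* Let $\Omega\subset\mathbb R^d$ be open, $\omega\in\mathcal W$, and let $h=[(h_\varepsilon)]\in\mathcal G^{(\omega)}(\Omega)$. If there exists $k>0$ such that for all $\rho\in\mathcal D^{(\omega),k}(\Omega)$ $$[(\langle h_\varepsilon,\rho\rangle)]=0\quad\text{in }\tilde{\mathbb C}^{(\omega)},$$ then $h=0$.
   Context: $\mathbb R^+=[0,\infty)$. $\mathcal W$ is the set of all nondecreasing continuous functions $\omega:\mathbb R^+\to\mathbb R^+$ such that $\omega(0)=0$; $\omega(x+y)\le\omega(x)+\omega(y)$ for all $x,y\ge 0$; $\int_1^\infty \frac{\omega(t)}{t^2}\,dt<\infty$; and $\lim_{t\to\infty}\frac{\omega(t)}{\log(1+t)}=\infty$. For a compactly supported continuous $f$ on $\mathbb R^d$ and $l>0$: $\|f\|_l^{\omega}=\int|\hat f(\xi)|e^{l\omega(|\xi|)}d\xi\in[0,\infty]$. $\mathcal D^{(\omega)}(\Omega)$ is the set of continuous $f$ with compact support in $\Omega$ and $\|f\|_l^\omega<\infty$ for all $l>0$. For $k>0$, $\mathcal D^{(\omega),k}(\Omega)$ is the set of functions $\rho \in L^2$ with compact support in $\Omega$ and $\left(\int|\hat\rho(\xi)|^2e^{2k\omega(|\xi|)}d\xi\right)^{1/2}<\infty$. $\mathcal E^{(\omega)}(\Omega)$ is the set of smooth $f:\Omega\to\mathbb C$ with $\psi f\in\mathcal D^{(\omega)}(\Omega)$ for all $\psi\in\mathcal D^{(\omega)}(\Omega)$; for compact $K\subset\Omega$, $\|f\|_{K,l}^{\omega}=\inf\{\|\psi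 f\|_l^{\omega}:\psi\in\mathcal D^{(\omega)}(\Omega),\ \psi=1\text{ on }K\}$. Nets in $\mathcal E^{(\omega)}(\Omega)$ are indexed by $\varepsilon\in(0,1)$, $o(\cdot)$ is as $\varepsilon\to0^+$, $K$ ranges over compact subsets of $\Omega$. Moderate: $\forall K\,\forall h>0\,\exists k>0$: $\|g_\varepsilon\|_{K,h}^\omega=o(e^{k\omega(1/\varepsilon)})$. Negligible: $\forall K\,\forall h>0\,\forall k>0$: $\|g_\varepsilon\|_{K,h}^\omega=o(e^{-k\omega(1/\varepsilon)})$. $\mathcal G^{(\omega)}(\Omega)$ is the quotient of moderate by negligible nets. $\langle h_\varepsilon,\rho\rangle=\int h_\varepsilon\rho$, and $[(r_\varepsilon)]=0$ in $\tilde{\mathbb C}^{(\omega)}$ means $|r_\varepsilon|=o(e^{-l\omega(1/\varepsilon)})$ for all $l>0$. *)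

(* Defs.v *)
From HB Require Import structures.
From mathcomp Require Import all_boot all_order all_algebra.
From mathcomp Require Import all_classical all_reals all_analysis complex.

Set Implicit Arguments.
Unset Strict Implicit.
Unset Printing Implicit Defensive.
Import Order.TTheory GRing.Theory Num.Theory.
Import numFieldNormedType.Exports.
Local Open Scope classical_set_scope.
Local Open Scope ring_scope.
Local Open Scope complex_scope.

(* 'rV[R]_n is R^n: the library gives it the product topology (norm = sup norm);
   it is equipped below with the product sigma-algebra, i.e., the Borel one. *)
Definition measure_rV_display : measure_display -> measure_display.
Proof. exact. Qed.

Section measurable_rV.
Context {R : realType} (n : nat).

Let coord : 'I_n -> 'rV[R]_n -> R := fun i v => v ord0 i.

Let rV_set0 : g_sigma_preimage coord set0.
Proof. exact: sigma_algebra0. Qed.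

Let rV_setC A : g_sigma_preimage coord A -> g_sigma_preimage coord (~` A).
Proof. exact: sigma_algebraC. Qed.

Let rV_bigcup (F : (set 'rV[R]_n)^nat) :
  (forall i, g_sigma_preimage coord (F i)) ->
  g_sigma_preimage coord (\bigcup_i (F i)).
Proof. exact: sigma_algebra_bigcup. Qed.

HB.instance Definition _ := @isMeasurable.Build
  (measure_rV_display default_measure_display)
  'rV[R]_n (g_sigma_preimage coord) rV_set0 rV_setC rV_bigcup.

Lemma measurable_rV_coord (i : 'I_n) :
  measurable_fun [set: 'rV[R]_n] (fun v => v ord0 i : R).
Proof.
move=> _ Y mY; rewrite setTI; apply: sub_sigma_algebra => /=.
rewrite -bigcup_seq/=; exists i => /=; first by rewrite mem_index_enum.
by exists Y => //; rewrite setTI.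
Qed.

Lemma measurable_fun_rV d (T : measurableType d) (f : T -> 'rV[R]_n) :
  (forall i, measurable_fun [set: T] (fun x => f x ord0 i : R)) ->
  measurable_fun [set: T] f.
Proof.
move=> mf _ A mA; rewrite setTI.
suff : g_sigma_preimage coord `<=` [set B | measurable (f @^-1` B)] by exact.
apply: smallest_sub.
  split=> [|B mB|F mF] /=.
  - by rewrite preimage_set0; exact: measurable0.
  - by rewrite setTD preimage_setC; exact: measurableC.
  - by rewrite preimage_bigcup; exact: bigcupT_measurable.
rewrite -bigcup_seq; apply: bigcup_sub => i _ _ [B mB <-].
rewrite /= !setTI -[X in measurable X]setTI.
exact: (mf i measurableT).
Qed.

End measurable_rV.

Section lebesgue_rV_cons.
Local Open Scope ereal_scope.
Context {R : realType} (n : nat).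

Definition row_cons (p : measurableTypeR R * 'rV[R]_n) : 'rV[R]_n.+1 :=
  \row_j oapp (p.2 ord0) p.1 (unlift ord0 j).

Definition row_uncons (v : 'rV[R]_n.+1) : measurableTypeR R * 'rV[R]_n :=
  (v ord0 ord0, \row_j v ord0 (lift ord0 j)).

Lemma row_consK : cancel row_cons row_uncons.
Proof.
case=> x v; rewrite /row_cons /row_uncons mxE unlift_none /=; congr (_, _).
by apply/rowP => j; rewrite !mxE liftK.
Qed.

Lemma row_unconsK : cancel row_uncons row_cons.
Proof.
move=> v; apply/rowP => j; rewrite mxE.
by case: unliftP => [k ->|->] /=; rewrite ?mxE.
Qed.

Lemma measurable_row_cons : measurable_fun [set: measurableTypeR R * 'rV[R]_n] row_cons.
Proof.
apply: measurable_fun_rV => j; case: (unliftP ord0 j) => [k ->|->].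
  rewrite (_ : (fun _ => _) = (fun v : 'rV[R]_n => v ord0 k) \o snd).
    apply: measurableT_comp; [exact: measurable_rV_coord|exact: measurable_snd].
  by apply/funext => p; rewrite mxE liftK.
rewrite (_ : (fun _ => _) = fst); first exact: measurable_fst.
by apply/funext => p; rewrite mxE unlift_none.
Qed.

Lemma measurable_row_uncons : measurable_fun [set: 'rV[R]_n.+1] row_uncons.
Proof.
apply/measurable_fun_pairP; split; first exact: measurable_rV_coord.
apply: measurable_fun_rV => j.
rewrite (_ : (fun _ => _) = fun v : 'rV[R]_n.+1 => v ord0 (lift ord0 j)).
  exact: measurable_rV_coord.
by apply/funext => v /=; rewrite mxE.
Qed.

Variable mu : {sigma_finite_measure set 'rV[R]_n -> \bar R}.

Definition lebesgue_rV_cons (A : set 'rV[R]_n.+1) : \bar R :=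
  pushforward (lebesgue_measure \x mu) row_cons A.

Let mpre A : measurable A -> measurable (row_cons @^-1` A).
Proof. by move=> mA; rewrite -[X in measurable X]setTI; exact: measurable_row_cons. Qed.

Let lebesgue_rV_cons0 : lebesgue_rV_cons set0 = 0.
Proof. by rewrite /lebesgue_rV_cons /pushforward preimage_set0 measure0. Qed.

Let lebesgue_rV_cons_ge0 A : 0 <= lebesgue_rV_cons A.
Proof. exact: (measure_ge0 (lebesgue_measure \x mu)). Qed.

Let lebesgue_rV_cons_sigma_additive : semi_sigma_additive lebesgue_rV_cons.
Proof.
move=> F mF tF mUF; rewrite /lebesgue_rV_cons /pushforward preimage_bigcup.
apply: measure_semi_sigma_additive.
- by move=> k; exact: mpre.
- apply/trivIsetP => /= i j _ _ ij; rewrite -preimage_setI.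
  by move/trivIsetP : tF => /(_ _ _ _ _ ij) ->//; rewrite preimage_set0.
- by rewrite -preimage_bigcup; exact: mpre.
Qed.

HB.instance Definition _ := isMeasure.Build _ _ _ lebesgue_rV_cons
  lebesgue_rV_cons0 lebesgue_rV_cons_ge0 lebesgue_rV_cons_sigma_additive.

Let lebesgue_rV_cons_sigma_finite : sigma_finite setT lebesgue_rV_cons.
Proof.
have /sigma_finiteP[F [FT ndF Foo]] := sigma_finiteT (@lebesgue_measure R).
have /sigma_finiteP[G [GT ndG Goo]] := sigma_finiteT mu.
exists (fun k => row_uncons @^-1` (F k `*` G k)).
  rewrite -preimage_bigcup; apply/esym/seteqP; split => // v _ /=.
  have : (setT : set (measurableTypeR R)) (row_uncons v).1 by [].
  have : (setT : set 'rV[R]_n) (row_uncons v).2 by [].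
  rewrite {1}GT {1}FT => -[k _ Gk] [l _ Fl]; exists (maxn k l) => //; split.
    by move: Fl; exact/subsetPset/ndF/leq_maxr.
  by move: Gk; exact/subsetPset/ndG/leq_maxl.
move=> k; have [mF Fk] := Foo k; have [mG Gk] := Goo k; split.
  rewrite -[X in measurable X]setTI.
  by apply: measurable_row_uncons => //; exact: measurableX.
rewrite /lebesgue_rV_cons /pushforward -comp_preimage.
rewrite (_ : _ \o _ = id); last by apply/funext => p /=; rewrite row_consK.
by rewrite preimage_id product_measure1E// lte_mul_pinfty// ge0_fin_numE.
Qed.

HB.instance Definition _ := Measure_isSigmaFinite.Build _ _ _
  lebesgue_rV_cons lebesgue_rV_cons_sigma_finite.

End lebesgue_rV_cons.

(* n-dimensional Lebesgue measure, as the n-fold product of lebesgue_measure *)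
Fixpoint lebesgue_rV (R : realType) (n : nat) :
    {sigma_finite_measure set 'rV[R]_n -> \bar R} :=
  match n with
  | 0 => \d_(0 : 'rV[R]_0)
  | m.+1 => lebesgue_rV_cons (lebesgue_rV R m)
  end.

Lemma lebesgue_rV_box (R : realType) n (A : 'I_n -> set R) :
  (forall i, measurable (A i)) ->
  lebesgue_rV R n [set v : 'rV[R]_n | forall i, A i (v ord0 i)] =
  (\prod_(i < n) lebesgue_measure (A i))%E.
Proof.
elim: n A => [|n IH] A mA.
  by rewrite big_ord0 /= diracE mem_set//= => -[].
rewrite /= /lebesgue_rV_cons /pushforward.
have -> : @row_cons R n @^-1` [set v | forall i, A i (v ord0 i)] =
    A ord0 `*` [set v : 'rV[R]_n | forall i, A (lift ord0 i) (v ord0 i)].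
  apply/seteqP; split => -[x v] /=.
    move=> Av; split=> [|i]; first by have := Av ord0; rewrite mxE unlift_none.
    by have := Av (lift ord0 i); rewrite mxE liftK.
  move=> [Ax Av] i; rewrite mxE.
  by case: (unliftP ord0 i) => [j ->|->] /=; [exact: Av|exact: Ax].
rewrite product_measure1E; [|exact: mA|].
  rewrite big_ord_recl; congr (_ * _)%E.
  by rewrite -(IH (fun i => A (lift ord0 i))).
rewrite (_ : [set v | _] = \big[setI/setT]_(i < n)
    ((fun v : 'rV[R]_n => v ord0 i) @^-1` A (lift ord0 i))).
  apply: bigsetI_measurable => i _; rewrite -[X in measurable X]setTI.
  by apply: measurable_rV_coord => //; exact: mA.
rewrite -bigcap_seq; apply/seteqP; split => v /= Av i; first by move=> _; exact: Av.
by apply: Av; rewrite /= mem_index_enum.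
Qed.

Record weight (R : realType) (om : R -> R) : Prop := Weight {
  weight_ge0 : forall x, 0 <= x -> 0 <= om x ;
  weight_nondecreasing : forall x y, 0 <= x -> x <= y -> om x <= om y ;
  weight_continuous : {within `[0, +oo[, continuous om} ;
  weight0 : om 0 = 0 ;
  weight_subadditive :
    forall x y, 0 <= x -> 0 <= y -> om (x + y) <= om x + om y ;
  weight_integral :
    (\int[lebesgue_measure]_(t in `[1%R, +oo[) (om t / t ^+ 2)%:E < +oo)%E ;
  weight_log : om t / ln (1 + t) @[t --> +oo] --> +oo }.

Section fourier.
Context {R : realType} {d : nat}.
Implicit Types (f g : 'rV[R]_d -> R[i]) (x xi : 'rV[R]_d) (om : R -> R).

Definition dotv x xi : R := \sum_(i < d) x ord0 i * xi ord0 i.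

Definition enorm x : R := Num.sqrt (dotv x x).

Definition cintegral (D : set 'rV[R]_d) f : R[i] :=
  (\int[lebesgue_rV R d]_(x in D) complex.Re (f x)) +i*
  (\int[lebesgue_rV R d]_(x in D) complex.Im (f x)).

(* convention: the transform of f at xi is the integral of f x e^{-i <x, xi>} *)
Definition fourier f xi : R[i] :=
  cintegral setT (fun x => f x * (cos (dotv x xi) -i* sin (dotv x xi))).

Definition fourier_norm om (l : R) f : \bar R :=
  (\int[lebesgue_rV R d]_xi
    (Normc.normc (fourier f xi) * expR (l * om (enorm xi)))%:E)%E.

End fourier.

Section function_spaces.
Context {R : realType} {d : nat}.
Implicit Types (f psi rho : 'rV[R]_d -> R[i]) (om : R -> R).
Implicit Types (Omega K : set 'rV[R]_d).

Definition csupport f : set 'rV[R]_d := closure [set x | f x != 0].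

(* Elements of the spaces over Omega are total functions; only their values
   on Omega matter.  A function with support in Omega vanishes off Omega. *)
Definition test_fun Omega om f : Prop :=
  [/\ continuous (f : 'rV[R]_d -> R[i]^o),
      compact (csupport f), csupport f `<=` Omega &
      forall l : R, 0 < l -> (fourier_norm om l f < +oo)%E].

(* rho is a representative of an L^2 class, so its support is meant up to a
   null set; rho is then integrable and its transform is an integral *)
Definition test_L2 Omega om (k : R) rho : Prop :=
  [/\ measurable_fun [set: 'rV[R]_d] (fun x => complex.Re (rho x)),
      measurable_fun [set: 'rV[R]_d] (fun x => complex.Im (rho x)),
      ('N[lebesgue_rV R d]_2%:E[EFin \o (@Normc.normc R \o rho)] < +oo)%E,
      exists K, [/\ compact K, K `<=` Omega &
        {ae lebesgue_rV R d, forall x, ~ K x -> rho x = 0}] &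
      ((\int[lebesgue_rV R d]_xi
          (Normc.normc (fourier rho xi) ^+ 2 *
           expR (2 * k * om (enorm xi)))%:E) `^ 2^-1 < +oo)%E].

Fixpoint iter_partial (s : seq 'I_d) (u : 'rV[R]_d -> R) : 'rV[R]_d -> R :=
  if s is i :: s' then fun x => 'D_(delta_mx ord0 i) (iter_partial s' u) x
  else u.

Definition smooth_on Omega (u : 'rV[R]_d -> R) : Prop :=
  forall (s : seq 'I_d) x, Omega x ->
    {for x, continuous (iter_partial s u)} /\
    (forall i, derivable (iter_partial s u) x (delta_mx ord0 i)).

Definition ultradiff_fun Omega om f : Prop :=
  [/\ smooth_on Omega (fun x => complex.Re (f x)),
      smooth_on Omega (fun x => complex.Im (f x)) &
      forall psi, test_fun Omega om psi ->
        test_fun Omega om (fun x => psi x * f x)].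

Definition local_norm Omega om K (l : R) f : \bar R :=
  ereal_inf [set fourier_norm om l (fun x => psi x * f x) | psi in
    [set psi | test_fun Omega om psi /\ forall x, K x -> psi x = 1]].

End function_spaces.

(* a = o(b) as e tends to 0+, for an extended-real-valued a *)
Definition elittleo0 (R : realType) (a : R -> \bar R) (b : R -> R) : Prop :=
  forall c : R, 0 < c -> \forall e \near 0^'+, (`|a e| <= (c * `|b e|)%:E)%E.

Section generalized_functions.
Context {R : realType} {d : nat}.
Variables (Omega : set 'rV[R]_d) (om : R -> R).
Implicit Types g h : R -> 'rV[R]_d -> R[i].

Definition is_net g : Prop :=
  forall e : R, 0 < e < 1 -> ultradiff_fun Omega om (g e).

Definition moderate g : Prop :=
  is_net g /\ forall K, compact K -> K `<=` Omega ->
    forall l : R, 0 < l -> exists2 k : R, 0 < k &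
      elittleo0 (fun e => local_norm Omega om K l (g e))
                (fun e => expR (k * om e^-1)).

Definition negligible_net g : Prop :=
  is_net g /\ forall K, compact K -> K `<=` Omega ->
    forall l : R, 0 < l -> forall k : R, 0 < k ->
      elittleo0 (fun e => local_norm Omega om K l (g e))
                (fun e => expR (- k * om e^-1)).

(* equality of the classes of two moderate nets in moderate / negligible *)
Definition eq_gen_fun g h : Prop :=
  negligible_net (fun e x => g e x - h e x).

End generalized_functions.

Definition null_gen_number (R : realType) (om : R -> R) (r : R -> R[i]) : Prop :=
  forall l : R, 0 < l ->
    elittleo0 (fun e => (Normc.normc (r e))%:E) (fun e => expR (- l * om e^-1)).

Definition pairing (R : realType) (d : nat) (Omega : set 'rV[R]_d)
    (h rho : 'rV[R]_d -> R[i]) : R[i] :=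
  cintegral Omega (fun x => h x * rho x).

(* Main.v *)
Require Import Defs.
From mathcomp Require Import all_boot all_order all_algebra.
From mathcomp Require Import all_classical all_reals all_analysis complex measurable_realfun.
From mathcomp Require Import ring lra.
Import numFieldNormedType.Exports.
Import Order.TTheory GRing.Theory Num.Theory.
Import Normc.
Local Open Scope classical_set_scope.
Local Open Scope ring_scope.
Set Implicit Arguments.
Unset Strict Implicit.
Unset Printing Implicit Defensive.

(** Fix a compact set K, a level l and a rate k'.  Moderateness makes the local
    norms of h_e finite for small e, so the infimum defining them runs over a
    nonempty set and there is a test function psi equal to 1 on K.  It suffices
    to bound the norm of level l of psi h_e by a large power of
    exp(- om (1/e)).  Three ideas do this.

    Uniformity.  The transform of psi h_e at y is the pairing of h_e with
    psi exp(-i <., y>), so the hypothesis makes it small for each single y.  It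
    is even small uniformly: for each L,
      |(psi h_e)^(y)| <= C exp(- L om (1/e)) exp(2 k om |y|)
    for all y and all small e ([uniform_fourier_bound]).  Otherwise there are
    e_j -> 0 and y_j for which this fails badly, and a [gliding_hump] produces
    signs s_j such that
      rho = psi * sum_j s_j 4^-j exp(- 2 k om |y_j|) exp(-i <., y_j>)
    has pairings with h_(e_j) that do not decay like exp(- L om (1/e_j)).  But
    rho is an admissible density ([modulated_test_L2]), since om is subadditive
    and multiplication by exp(-i <., y_j>) translates transforms by y_j.

    Moderateness for one fixed cut-off.  Moderateness on the support of psi
    gives cut-offs p_e, depending on e, with the norms of p_e h_e under control.
    Since psi h_e = psi (p_e h_e), the norms of psi h_e are moderate too, because
    the norms are submultiplicative up to a constant ([fourier_norm_mul_le]):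
    the transform of a product is a convolution, and om is subadditive.  That
    rests on [fourier_inversion], which is proved by Abel summation: the factor
    prod_i exp(- dl |y_i|) has the product Poisson kernel as its transform,
    whose mass (2 pi)^n does not depend on dl and concentrates at 0 as dl -> 0.

    Interpolation.  A pointwise bound of size b^2 and a norm of a higher level
    give a bound of size b on the norm of level l ([interpolation]), because
    exp(- om |y|) is integrable: om grows faster than the logarithm.  Choosing L
    large against the growth exponent of the higher norm concludes. *)

(** * Complex-valued functions and their integrals *)

Section complex_modulus.
Context {R : rcfType}.
Implicit Types (z w : R[i]) (a : R).
Local Notation Re := (@complex.Re R).
Local Notation Im := (@complex.Im R).

Lemma normc_ge0 z : 0 <= normc z.
Proof. by case: z => a b; exact: sqrtr_ge0. Qed.

Lemma normc_le_add z w : normc (z + w) <= normc z + normc w.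
Proof. exact: le_normcD. Qed.

Lemma normc_opp z : normc (- z) = normc z.
Proof. exact: normcN. Qed.

Lemma normc_subC z w : normc (z - w) = normc (w - z).
Proof. by rewrite -normc_opp opprB. Qed.

Lemma normc_real a : normc (real_complex R a) = `|a|.
Proof. by rewrite /= expr0n /= addr0 sqrtr_sqr. Qed.

Lemma normc_sum (I : Type) (r : seq I) (P : pred I) (F : I -> R[i]) :
  normc (\sum_(i <- r | P i) F i) <= \sum_(i <- r | P i) normc (F i).
Proof.
elim/big_ind2 : _ => //; first by rewrite normc0.
move=> z a w b za wb.
by rewrite (le_trans (normc_le_add _ _))// lerD.
Qed.

Lemma normc_prod (I : Type) (r : seq I) (P : pred I) (F : I -> R[i]) :
  normc (\prod_(i <- r | P i) F i) = \prod_(i <- r | P i) normc (F i).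
Proof. by elim/big_ind2 : _ => //; rewrite ?normc1// => z a w b; rewrite normcM => -> ->. Qed.

Lemma normr_Re_le z : `|Re z| <= normc z.
Proof. by case: z => a b /=; rewrite -sqrtr_sqr ler_wsqrtr// lerDl sqr_ge0. Qed.

Lemma normr_Im_le z : `|Im z| <= normc z.
Proof. by case: z => a b /=; rewrite -sqrtr_sqr ler_wsqrtr// lerDr sqr_ge0. Qed.

Lemma normc_le_ReIm z : normc z <= `|Re z| + `|Im z|.
Proof.
rewrite [leLHS](_ : _ = normc ((Re z)%:C + 'i * (Im z)%:C)%C); last first.
  by congr normc; exact: complexE.
rewrite (le_trans (normc_le_add _ _))// normc_real lerD2l normcM normc_real.
by rewrite /= expr0n /= expr1n add0r sqrtr1 mul1r.
Qed.

Lemma normc_sqr z : normc z ^+ 2 = Re z ^+ 2 + Im z ^+ 2.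
Proof. by case: z => a b /=; rewrite sqr_sqrtr// addr_ge0 ?sqr_ge0. Qed.

Lemma Re_mul z w : Re (z * w) = Re z * Re w - Im z * Im w.
Proof. by case: z; case: w. Qed.

Lemma Im_mul z w : Im (z * w) = Re z * Im w + Im z * Re w.
Proof. by case: z; case: w. Qed.

Lemma Re_add z w : Re (z + w) = Re z + Re w.
Proof. by case: z; case: w. Qed.

Lemma Im_add z w : Im (z + w) = Im z + Im w.
Proof. by case: z; case: w. Qed.

Lemma complex_eq z w : Re z = Re w -> Im z = Im w -> z = w.
Proof. by case: z w => a b [c e] /= -> ->. Qed.

End complex_modulus.

Section complex_measurable.
Context {R : realType} d (T : measurableType d).
Implicit Types (f g : T -> R[i]).
Local Notation Re := (@complex.Re R).
Local Notation Im := (@complex.Im R).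

Definition cmeasurable f : Prop :=
  measurable_fun [set: T] (Re \o f) /\ measurable_fun [set: T] (Im \o f).

Lemma cmeasurable_cst z : cmeasurable (fun _ => z).
Proof. by split; exact: measurable_cst. Qed.

Lemma cmeasurable_real (f : T -> R) :
  measurable_fun [set: T] f -> cmeasurable (fun x => real_complex R (f x)).
Proof. by move=> mf; split=> //; exact: measurable_cst. Qed.

Lemma cmeasurableD f g : cmeasurable f -> cmeasurable g ->
  cmeasurable (fun x => f x + g x).
Proof.
move=> [mf mf'] [mg mg']; split.
  rewrite (_ : _ \o _ = (Re \o f) \+ (Re \o g)); first exact: measurable_funD.
  by apply/funext => x /=; rewrite Re_add.
rewrite (_ : _ \o _ = (Im \o f) \+ (Im \o g)); first exact: measurable_funD.
by apply/funext => x /=; rewrite Im_add.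
Qed.

Lemma cmeasurableM f g : cmeasurable f -> cmeasurable g ->
  cmeasurable (fun x => f x * g x).
Proof.
move=> [mf mf'] [mg mg']; split.
  rewrite (_ : _ \o _ =
    ((Re \o f) \* (Re \o g)) \- ((Im \o f) \* (Im \o g))).
    by apply: measurable_funB; exact: measurable_funM.
  by apply/funext => x /=; rewrite Re_mul.
rewrite (_ : _ \o _ = ((Re \o f) \* (Im \o g)) \+ ((Im \o f) \* (Re \o g))).
  by apply: measurable_funD; exact: measurable_funM.
by apply/funext => x /=; rewrite Im_mul.
Qed.

Lemma cmeasurableN f : cmeasurable f -> cmeasurable (fun x => - f x).
Proof.
move=> mf; rewrite (_ : (fun x => _) = fun x => real_complex R (-1) * f x).
  by apply: cmeasurableM => //; exact: cmeasurable_cst.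
by apply/funext => x; rewrite rmorphN1 mulN1r.
Qed.

Lemma cmeasurable_prod (I : Type) (r : seq I) (F : I -> T -> R[i]) :
  (forall i, cmeasurable (F i)) -> cmeasurable (fun x => \prod_(i <- r) F i x).
Proof.
move=> mF; elim: r => [|i r IH].
  by under eq_fun do rewrite big_nil; exact: cmeasurable_cst.
by under eq_fun do rewrite big_cons; exact: cmeasurableM.
Qed.

Lemma measurable_normc f : cmeasurable f -> measurable_fun [set: T] (fun x => normc (f x)).
Proof.
move=> [mf mf'].
rewrite (_ : (fun x => _) = (@Num.sqrt R) \o
    (fun x => Re (f x) ^+ 2 + Im (f x) ^+ 2)).
  apply: measurableT_comp; first by apply: continuous_measurable_fun; exact: sqrt_continuous.
  by apply: measurable_funD; apply: measurable_funX.
by apply/funext => x /=; case: (f x).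
Qed.

End complex_measurable.

Lemma cmeasurableT_comp {R : realType} d1 (T1 : measurableType d1) d2 (T2 : measurableType d2)
  (f : T2 -> R[i]) (g : T1 -> T2) :
  cmeasurable f -> measurable_fun [set: T1] g -> cmeasurable (fun x => f (g x)).
Proof.
by move=> [mf mf'] mg; split; [exact: (measurableT_comp mf mg)|exact: (measurableT_comp mf' mg)].
Qed.

Section complex_integral.
Context {R : realType} d (T : measurableType d).
Variable mu : {measure set T -> \bar R}.
Implicit Types (f g : T -> R[i]).
Local Notation Re := (@complex.Re R).
Local Notation Im := (@complex.Im R).

Definition cint f : R[i] :=
  Complex (\int[mu]_x Re (f x)) (\int[mu]_x Im (f x)).

Definition cintegrable f : Prop :=
  cmeasurable f /\ (\int[mu]_x (normc (f x))%:E < +oo)%E.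

Lemma cintegrable_Re f : cintegrable f ->
  mu.-integrable [set: T] (EFin \o (fun x => Re (f x))).
Proof.
move=> [mf foo]; apply/integrableP; split.
  by apply/measurable_EFinP; exact: mf.1.
apply: le_lt_trans foo; apply: ge0_le_integral => //.
- by apply/measurableT_comp => //; apply/measurable_EFinP; exact: mf.1.
- by apply/measurable_EFinP; exact: measurable_normc.
- by move=> x _ /=; rewrite lee_fin normr_Re_le.
Qed.

Lemma cintegrable_Im f : cintegrable f ->
  mu.-integrable [set: T] (EFin \o (fun x => Im (f x))).
Proof.
move=> [mf foo]; apply/integrableP; split.
  by apply/measurable_EFinP; exact: mf.2.
apply: le_lt_trans foo; apply: ge0_le_integral => //.
- by apply/measurableT_comp => //; apply/measurable_EFinP; exact: mf.2.
- by apply/measurable_EFinP; exact: measurable_normc.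
- by move=> x _ /=; rewrite lee_fin normr_Im_le.
Qed.

Lemma cintegrable_normc f : cintegrable f ->
  mu.-integrable [set: T] (EFin \o (fun x => normc (f x))).
Proof.
move=> [mf foo]; apply/integrableP; split.
  by apply/measurable_EFinP; exact: measurable_normc.
by under eq_integral do rewrite /= ger0_norm ?normc_ge0//.
Qed.

Lemma ge0_le_intEFin (f g : T -> R) : measurable_fun [set: T] f ->
  measurable_fun [set: T] g -> (forall x, 0 <= f x <= g x) ->
  (\int[mu]_x (f x)%:E <= \int[mu]_x (g x)%:E)%E.
Proof.
move=> mf mg fg; apply: ge0_le_integral => //.
- by move=> x _; rewrite lee_fin; case/andP: (fg x).
- exact/measurable_EFinP.
- exact/measurable_EFinP.
- by move=> x _; rewrite lee_fin; case/andP: (fg x).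
Qed.

Lemma cintegrable_le f (g : T -> R) : cmeasurable f ->
  measurable_fun [set: T] g -> (\int[mu]_x (g x)%:E < +oo)%E ->
  (forall x, normc (f x) <= g x) -> cintegrable f.
Proof.
move=> mf mg goo fg; split => //; apply: le_lt_trans goo.
apply: ge0_le_intEFin => //; first exact: measurable_normc.
by move=> x; rewrite normc_ge0 fg.
Qed.

Lemma cintegrableD f g : cintegrable f -> cintegrable g ->
  cintegrable (fun x => f x + g x).
Proof.
move=> [mf foo] [mg goo].
apply: (@cintegrable_le _ (fun x => normc (f x) + normc (g x))).
- exact: cmeasurableD.
- by apply: measurable_funD; exact: measurable_normc.
- under eq_integral do rewrite EFinD.
  rewrite ge0_integralD//; first by rewrite lte_add_pinfty.
  + by move=> x _; rewrite lee_fin normc_ge0.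
  + by apply/measurable_EFinP; exact: measurable_normc.
  + by move=> x _; rewrite lee_fin normc_ge0.
  + by apply/measurable_EFinP; exact: measurable_normc.
- by move=> x; exact: normc_le_add.
Qed.

Lemma cintegrableZ z f : cintegrable f -> cintegrable (fun x => z * f x).
Proof.
move=> [mf foo].
apply: (@cintegrable_le _ (fun x => normc z * normc (f x))).
- by apply: cmeasurableM => //; exact: cmeasurable_cst.
- by apply: measurable_funM => //; exact: measurable_normc.
- under eq_integral do rewrite EFinM.
  rewrite ge0_integralZl//; first by rewrite lte_mul_pinfty// lee_fin normc_ge0.
  + by apply/measurable_EFinP; exact: measurable_normc.
  + by move=> x _; rewrite lee_fin normc_ge0.
  + by rewrite lee_fin normc_ge0.
- by move=> x; rewrite normcM.
Qed.

Lemma cintegrableN f : cintegrable f -> cintegrable (fun x => - f x).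
Proof.
move=> [mf foo]; split; first exact: cmeasurableN.
by under eq_integral do rewrite normc_opp.
Qed.

Lemma cintD f g : cintegrable f -> cintegrable g ->
  cint (fun x => f x + g x) = cint f + cint g.
Proof.
move=> fi gi; apply: complex_eq; rewrite /cint /=.
  under eq_Rintegral do rewrite Re_add.
  by rewrite RintegralD//; exact: cintegrable_Re.
under eq_Rintegral do rewrite Im_add.
by rewrite RintegralD//; exact: cintegrable_Im.
Qed.

Lemma cintZ z f : cintegrable f -> cint (fun x => z * f x) = z * cint f.
Proof.
move=> fi; have fR := cintegrable_Re fi; have fI := cintegrable_Im fi.
have iZ (a : R) (g : T -> R) : mu.-integrable setT (EFin \o g) ->
    mu.-integrable setT (EFin \o (fun x => a * g x)).
  by move=> ig; rewrite (_ : _ \o _ = (fun x => a%:E * (g x)%:E)%E)//; exact: integrableZl.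
apply: complex_eq; rewrite /cint ?Re_mul ?Im_mul /=.
  under eq_Rintegral do rewrite Re_mul.
  by rewrite RintegralB ?RintegralZl//; exact: iZ.
under eq_Rintegral do rewrite Im_mul.
by rewrite RintegralD ?RintegralZl//; exact: iZ.
Qed.

Lemma cintN f : cintegrable f -> cint (fun x => - f x) = - cint f.
Proof.
move=> fi; rewrite -[RHS]mulN1r -cintZ//.
by congr cint; apply/funext => x; rewrite mulN1r.
Qed.

Lemma cintegrable0 : cintegrable (fun _ => 0).
Proof.
split; first exact: cmeasurable_cst.
by under eq_integral do rewrite normc0; rewrite integral0.
Qed.

Lemma cint0 : cint (fun _ => 0) = 0.
Proof. by rewrite /cint /Rintegral /= integral0. Qed.

Lemma cint_sum (I : Type) (r : seq I) (F : I -> T -> R[i]) :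
  (forall i, cintegrable (F i)) ->
  cintegrable (fun x => \sum_(i <- r) F i x) /\
  cint (fun x => \sum_(i <- r) F i x) = \sum_(i <- r) cint (F i).
Proof.
move=> iF; elim: r => [|i r [IH IH']].
  under eq_fun do rewrite big_nil.
  by rewrite big_nil cint0; split=> //; exact: cintegrable0.
under eq_fun do rewrite big_cons; rewrite big_cons.
by split; [exact: cintegrableD|rewrite cintD// IH'].
Qed.

(** With z the conjugate of the integral, the integral of z f is the real
    number |z|^2, and its integrand has real part at most |z| |f|. *)
Lemma normc_cint_le f : cintegrable f ->
  ((normc (cint f))%:E <= \int[mu]_x (normc (f x))%:E)%E.
Proof.
move=> fi; set I := cint f; have [I0|I0] := eqVneq (normc I) 0.
  by rewrite I0 integral_ge0// => x _; rewrite lee_fin normc_ge0.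
have Igt0 : 0 < normc I by rewrite lt_neqAle eq_sym I0 normc_ge0.
have ni := cintegrable_normc fi.
rewrite -[leRHS]fineK; last exact: (integrable_fin_num measurableT ni).
rewrite lee_fin -(ler_pM2l Igt0) -expr2.
pose z := Complex (Re I) (- Im I).
have nz : normc z = normc I by rewrite /z; case: (I) => a b /=; rewrite sqrrN.
have -> : normc I ^+ 2 = Re (cint (fun x => z * f x)).
  by rewrite cintZ// Re_mul normc_sqr /= mulNr opprK !expr2.
change (fine _) with (\int[mu]_x (normc (f x))).
rewrite -RintegralZl//; apply: le_Rintegral => //.
- exact/cintegrable_Re/cintegrableZ.
- rewrite (_ : _ \o _ = (fun x => (normc I)%:E * (normc (f x))%:E)%E)//.
  exact: integrableZl.
- by move=> x _; rewrite (le_trans (ler_norm _))// (le_trans (normr_Re_le _))// normcM nz.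
Qed.

Lemma normc_cint_le_bound f (M : R) : cintegrable f ->
  (\int[mu]_x (normc (f x))%:E <= M%:E)%E -> normc (cint f) <= M.
Proof. by move=> fi fM; rewrite -lee_fin (le_trans (normc_cint_le fi)). Qed.

End complex_integral.

Section real_fubini.
Context {R : realType} d1 (T1 : measurableType d1) d2 (T2 : measurableType d2).
Variables (m1 : {sigma_finite_measure set T1 -> \bar R}).
Variables (m2 : {sigma_finite_measure set T2 -> \bar R}).
Variable g : T1 * T2 -> R.
Hypothesis ig : (m1 \x m2)%E.-integrable [set: T1 * T2] (EFin \o g).

Lemma Rintegral12_prod :
  \int[m1]_x \int[m2]_y g (x, y) = fine (\int[(m1 \x m2)%E]_z (g z)%:E)%E.
Proof.
rewrite /Rintegral -(integral12_prod_meas1 ig); congr fine.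
apply: ae_eq_integral => //.
- apply/measurable_EFinP; apply: (measurableT_comp (fine_measurable measurableT)); exact: (measurable_fubini_F ig).
- exact: (measurable_fubini_F ig).
- have := ae_integrable1 ig; apply: filterS => x ix _ /=.
  by rewrite fineK//; exact: (integrable_fin_num measurableT ix).
Qed.

Lemma Rintegral21_prod :
  \int[m2]_y \int[m1]_x g (x, y) = fine (\int[(m1 \x m2)%E]_z (g z)%:E)%E.
Proof.
rewrite /Rintegral -(integral21_prod_meas1 ig); congr fine.
apply: ae_eq_integral => //.
- apply/measurable_EFinP; apply: (measurableT_comp (fine_measurable measurableT)); exact: (measurable_fubini_G ig).
- exact: (measurable_fubini_G ig).
- have := ae_integrable2 ig; apply: filterS => x ix _ /=.
  by rewrite fineK//; exact: (integrable_fin_num measurableT ix).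
Qed.

End real_fubini.

Section complex_fubini.
Context {R : realType} d1 (T1 : measurableType d1) d2 (T2 : measurableType d2).
Variables (m1 : {sigma_finite_measure set T1 -> \bar R}).
Variables (m2 : {sigma_finite_measure set T2 -> \bar R}).
Variable f : T1 * T2 -> R[i].

Lemma cint_prod_integrable : cmeasurable f ->
  (\int[m1]_x \int[m2]_y (normc (f (x, y)))%:E < +oo)%E ->
  cintegrable (m1 \x m2)%E f.
Proof.
move=> mf foo; split => //.
rewrite fubini_tonelli1//=; first by apply/measurable_EFinP; exact: measurable_normc.
by move=> x; rewrite lee_fin normc_ge0.
Qed.

Lemma cint12_prod : cintegrable (m1 \x m2)%E f ->
  cint m1 (fun x => cint m2 (fun y => f (x, y))) = cint (m1 \x m2)%E f.
Proof.
move=> fi; rewrite /cint /=; congr Complex.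
  exact: (Rintegral12_prod (cintegrable_Re fi)).
exact: (Rintegral12_prod (cintegrable_Im fi)).
Qed.

Lemma cint21_prod : cintegrable (m1 \x m2)%E f ->
  cint m2 (fun y => cint m1 (fun x => f (x, y))) = cint (m1 \x m2)%E f.
Proof.
move=> fi; rewrite /cint /=; congr Complex.
  exact: (Rintegral21_prod (cintegrable_Re fi)).
exact: (Rintegral21_prod (cintegrable_Im fi)).
Qed.

Lemma cint_fubini : cmeasurable f ->
  (\int[m1]_x \int[m2]_y (normc (f (x, y)))%:E < +oo)%E ->
  cint m1 (fun x => cint m2 (fun y => f (x, y))) =
  cint m2 (fun y => cint m1 (fun x => f (x, y))).
Proof.
move=> mf foo; have fi := cint_prod_integrable mf foo.
by rewrite cint12_prod// cint21_prod.
Qed.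

(** The integrals of the positive and of the negative part are measurable in
    the parameter even where they are infinite. *)
Lemma cmeasurable_cint : cmeasurable f ->
  cmeasurable (fun x => cint m2 (fun y => f (x, y))).
Proof.
suff H (g : T1 * T2 -> R) : measurable_fun setT g ->
    measurable_fun setT (fun x => \int[m2]_y g (x, y)).
  by move=> [mf mf']; split; [exact: (H _ mf)|exact: (H _ mf')].
move=> mg; apply: (measurableT_comp (fine_measurable measurableT)).
rewrite (_ : (fun x => _) =
  (fun x => (\int[m2]_y (EFin \o g)^\+ (x, y)) -
     (\int[m2]_y (EFin \o g)^\- (x, y))))%E.
  have mg' : measurable_fun setT (EFin \o g) by exact/measurable_EFinP.
  apply: emeasurable_funB.
    apply: measurable_fun_fubini_tonelli_F => //.
    exact: measurable_funepos.
  apply: measurable_fun_fubini_tonelli_F => //.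
  exact: measurable_funeneg.
by apply/funext => x; rewrite [LHS]integralE; congr (_ - _)%E; apply: eq_integral => y _; rewrite ?funeposE ?funenegE.
Qed.

End complex_fubini.

(** * Borel sets and Lebesgue measure on row vectors *)

Section borel_rV.
Context {R : realType} (n : nat).
Local Notation V := 'rV[R]_n.

Lemma measurable_rV_box (I : 'I_n -> set R) : (forall i, measurable (I i)) ->
  measurable [set x : V | forall i, I i (x ord0 i)].
Proof.
move=> mI; rewrite (_ : [set x | _] = \big[setI/setT]_(i < n)
    ((fun v : V => v ord0 i) @^-1` I i)).
  apply: bigsetI_measurable => i _; rewrite -[X in measurable X]setTI.
  by apply: measurable_rV_coord => //; exact: mI.
rewrite -bigcap_seq; apply/seteqP; split => v /= Iv i; first by move=> _; exact: Iv.
by apply: Iv; rewrite /= mem_index_enum.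
Qed.

Lemma measurable_rV_ball (c : V) (e : R) :
  measurable [set x : V | forall i, `|x ord0 i - c ord0 i| < e].
Proof.
apply: (measurable_rV_box (I := fun i => [set t : R | `|t - c ord0 i| < e])) => i.
rewrite (_ : [set t : R | _] = ball (c ord0 i) e); first exact: measurable_ball.
by apply/seteqP; split => t /=; rewrite /ball /= distrC.
Qed.

(** An open set is the union of the cubes it contains that have a rational
    centre and a radius 1/(k+1). *)
Lemma open_measurable_rV (U : set V) : open U -> measurable U.
Proof.
move=> oU.
pose B (p : 'rV[rat]_n * nat) : set V :=
  [set x | forall i, `|x ord0 i - (map_mx ratr p.1 : V) ord0 i| < p.2.+1%:R^-1].
pose C p : set V := if `[< B p `<=` U >] then B p else set0.
have -> : U = \bigcup_p C p.
  apply/seteqP; split => [x Ux|x [p _]]; last first.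
    by rewrite /C; case: asboolP => // BU /BU.
  have /nbhs_ballP [e /= e0 eU] : nbhs x U by exact: open_nbhs_nbhs.
  pose k := Num.truncn (2 / e).
  have ke : k.+1%:R^-1 < e / 2.
    rewrite -[e / 2]invf_div ltf_pV2 ?posrE ?divr_gt0//.
    by rewrite truncnS_gt.
  have [r [r0 re rE]] : exists r : R, [/\ 0 < r, r < e / 2 & r = k.+1%:R^-1].
    by exists k.+1%:R^-1; rewrite invr_gt0.
  have /choice[q qP] : forall i, exists q : rat, `|x ord0 i - ratr q| < r.
    move=> i; have kx : x ord0 i - r < x ord0 i + r by lra.
    have [q] := rat_in_itvoo kx.
    rewrite in_itv /= => /andP[q1 q2]; exists q.
    by rewrite ltr_norml; apply/andP; split; lra.
  exists (\row_i q i, k) => //.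
  rewrite /C asboolT.
    by move=> i /=; rewrite !mxE -rE.
  move=> y By; apply: eU; split=> // j i; rewrite (ord1 j).
  have := By i; rewrite /= !mxE -rE /ball /= => h1.
  have h2 := qP i.
  have -> : x ord0 i - y ord0 i = (x ord0 i - ratr (q i)) - (y ord0 i - ratr (q i)).
    by ring.
  rewrite (le_lt_trans (ler_normB _ _))//; lra.
apply: countable_bigcupT_measurable => [|p]; first exact: countableP.
rewrite /C; case: asboolP => _ //; exact: measurable_rV_ball.
Qed.

Lemma continuous_measurable_rV (f : V -> R) :
  continuous f -> measurable_fun [set: V] f.
Proof.
move=> cf; apply: (measurability _ (RGenOpens.measurableE R)).
move=> _ [_ [a [b ->] <-]]; rewrite setTI; apply: open_measurable_rV.
by move/continuousP : cf; apply; exact: interval_open.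
Qed.

Lemma measurable_dotv d (T : measurableType d) (f g : T -> V) :
  measurable_fun setT f -> measurable_fun setT g ->
  measurable_fun setT (fun t => dotv (f t) (g t)).
Proof.
move=> mf mg; rewrite /dotv; apply: measurable_sum => i.
by apply: measurable_funM; apply: (measurableT_comp (measurable_rV_coord i)).
Qed.

Lemma measurable_enorm : measurable_fun setT (@enorm R n).
Proof.
apply: (measurableT_comp (f := @Num.sqrt R)).
  by apply: continuous_measurable_fun; exact: sqrt_continuous.
by apply: measurable_dotv.
Qed.

Lemma measurable_rV_addr (w : V) : measurable_fun setT (fun v : V => v + w).
Proof.
apply: measurable_fun_rV => i.
under eq_fun do rewrite mxE.
by apply: measurable_funD => //; exact: measurable_rV_coord.
Qed.

End borel_rV.

Section continuous_complex.
Context {R : realType} (n : nat).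
Implicit Types f : 'rV[R]_n -> R[i].

Lemma continuous_complex_rV f (x : 'rV[R]_n) (e : R) :
  continuous (f : 'rV[R]_n -> R[i]^o) -> 0 < e ->
  exists2 r : R, 0 < r & forall y : 'rV[R]_n,
    (forall i, `|y ord0 i - x ord0 i| < r) -> normc (f y - f x) < e.
Proof.
move=> cf e0; have eC : 0 < (real_complex R e) by rewrite ltcR.
have h := (@cvgrPdist_lt _ _ _ (nbhs x) (nbhs_filter x) _ _).1 (cf x) _ eC.
have /nbhs_ballP[r /= r0 rf] := h.
exists r => // y xy; have /= := rf y.
rewrite normc_subC normc_def ltcR => fxy.
have -> : normc (f x - f y) =
    Num.sqrt (complex.Re (f x - f y) ^+ 2 + complex.Im (f x - f y) ^+ 2).
  by case: (f x - f y).
by apply: fxy; split => // i j; rewrite (ord1 i) /ball /= distrC.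
Qed.

Lemma continuous_cmeasurable f :
  continuous (f : 'rV[R]_n -> R[i]^o) -> cmeasurable f.
Proof.
move=> cf.
have H (g : R[i] -> R) : (forall z, `|g z| <= normc z) ->
  {morph g : x y / x - y} -> measurable_fun setT (fun x => g (f x)).
  move=> g1 gB; apply: continuous_measurable_rV => x.
  apply/(@cvgrPdist_lt _ _ _ (nbhs x) (nbhs_filter x) _ _) => e e0.
  have [r r0 xr] := continuous_complex_rV x cf e0.
  apply/nbhs_ballP; exists r => //= y [_ xy].
  rewrite -gB (le_lt_trans (g1 _))// normc_subC xr// => i.
  by rewrite distrC; exact: xy.
split; [apply: (H (@complex.Re R))|apply: (H (@complex.Im R))].
- exact: normr_Re_le.
- by case=> a b [c e].
- exact: normr_Im_le.
- by case=> a b [c e].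
Qed.

End continuous_complex.

Section translation.
Local Open Scope ereal_scope.
Context {R : realType}.

(** A measure on the line is determined by its values on half-open intervals,
    and translation preserves their length. *)
Lemma lebesgue_measure_translation (a : R) (A : set R) : measurable A ->
  lebesgue_measure ((fun x : measurableTypeR R => (x + a)%R : measurableTypeR R) @^-1` A) = lebesgue_measure A.
Proof.
pose phi (x : measurableTypeR R) : measurableTypeR R := (x + a)%R.
have mphi : measurable_fun setT phi by apply: measurable_funD.
pose m_of : {measure set (measurableTypeR R) -> \bar R} := pushforward lebesgue_measure phi.
pose m := m_of mphi.
move=> mA; suff H X : ocitv X -> lebesgue_measure X = m X.
  by have := lebesgue_measure_unique H mA => ->.
move=> [[b c]] _ <-; rewrite /m /m_of /= /pushforward (_ : phi @^-1` _ = `](b - a)%R, (c - a)%R]%classic).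
  rewrite !lebesgue_measure_itv/= !lte_fin ltrD2r.
  by case: ifP => // _; rewrite -!EFinB; congr EFin; ring.
by apply/seteqP; split => x /=; rewrite !in_itv /= /phi ltrBlDr lerBrDr.
Qed.

Lemma ge0_integral_translation1 (a : R) (f : R -> \bar R) : measurable_fun setT f ->
  (forall x, 0 <= f x) ->
  \int[lebesgue_measure]_x f (x + a)%R = \int[lebesgue_measure]_x f x.
Proof.
move=> mf f0.
pose phi (x : measurableTypeR R) : measurableTypeR R := (x + a)%R.
have mphi : measurable_fun setT phi by apply: measurable_funD.
transitivity (\int[pushforward lebesgue_measure phi]_(x in setT) f x).
  by rewrite ge0_integral_pushforward//= preimage_setT.
by apply: eq_measure_integral => A mA _; exact: lebesgue_measure_translation.
Qed.

(** The measure in dimension n.+1 is the image of a product measure under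
    [row_cons], so this is Tonelli's theorem; it is what makes inductions on the
    dimension work below. *)
Lemma ge0_integral_cons n (F : 'rV[R]_n.+1 -> \bar R) : measurable_fun setT F ->
  (forall x, 0 <= F x) ->
  \int[lebesgue_rV R n.+1]_v F v =
  \int[lebesgue_measure]_t \int[lebesgue_rV R n]_v F (row_cons (t, v)).
Proof.
move=> mF F0.
transitivity (\int[pushforward (lebesgue_measure \x lebesgue_rV R n) (@row_cons R n)]_v F v).
  apply: eq_measure_integral => [|A mA _]; [exact: measurable_row_cons|by []].
rewrite ge0_integral_pushforward//= ?preimage_setT; last exact: measurable_row_cons.
rewrite fubini_tonelli1//.
by apply: measurableT_comp => //; exact: measurable_row_cons.
Qed.
End translation.

Section rV_integrals.
Local Open Scope ereal_scope.
Context {R : realType}.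

Lemma row_consD n (t : R) (v : 'rV[R]_n) (w : 'rV[R]_n.+1) :
  (row_cons (t, v) + w =
  row_cons ((t + w ord0 ord0)%R, (v + \row_j w ord0 (lift ord0 j))%R))%R.
Proof.
apply/rowP => j; rewrite !mxE /=.
by case: unliftP => [k ->|->] /=; rewrite ?mxE.
Qed.

Lemma measurable_row_cons_comp n (F : 'rV[R]_n.+1 -> \bar R) t :
  measurable_fun setT F -> measurable_fun setT (fun v => F (row_cons (t, v))).
Proof.
move=> mF; apply: (measurableT_comp mF).
apply: (measurableT_comp (@measurable_row_cons R n)).
exact: pair1_measurable.
Qed.

Lemma ge0_integral_translation n (w : 'rV[R]_n) (F : 'rV[R]_n -> \bar R) :
  measurable_fun setT F -> (forall x, 0 <= F x) ->
  \int[lebesgue_rV R n]_v F (v + w)%R = \int[lebesgue_rV R n]_v F v.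
Proof.
elim: n w F => [|n IH] w F mF F0.
  by apply: eq_integral => v _; congr F; rewrite [LHS]thinmx0 [RHS]thinmx0.
have mFw : measurable_fun setT (fun v : 'rV[R]_n.+1 => F (v + w)%R).
  by apply: (measurableT_comp mF); exact: measurable_rV_addr.
rewrite (ge0_integral_cons mFw (fun v : 'rV[R]_n.+1 => F0 (v + w)%R)) (ge0_integral_cons mF F0).
pose G t := \int[lebesgue_rV R n]_v F (row_cons (t, v)).
transitivity (\int[lebesgue_measure]_t G (t + w ord0 ord0)%R).
  apply: eq_integral => t _.
  under eq_integral do rewrite row_consD.
  rewrite (IH _ (fun v => F (row_cons ((t + w ord0 ord0)%R, v))))//.
  exact: measurable_row_cons_comp.
apply: (@ge0_integral_translation1 _ _ G) => [|t]; last exact: integral_ge0.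
apply: (measurable_fun_fubini_tonelli_F (fun p => F (row_cons p))) => //.
by apply: (measurableT_comp mF); exact: measurable_row_cons.
Qed.

Lemma measurable_rV_prod n (g : 'I_n -> R -> R) :
  (forall i, measurable_fun setT (g i)) ->
  measurable_fun setT (fun v : 'rV[R]_n => \prod_(i < n) g i (v ord0 i))%R.
Proof.
move=> mg; apply: measurable_prod => i _.
exact: (measurableT_comp (mg i) (measurable_rV_coord i)).
Qed.

Lemma row_cons0 n (t : R) (v : 'rV[R]_n) : row_cons (t, v) ord0 ord0 = t.
Proof. by rewrite mxE unlift_none. Qed.

Lemma row_cons_lift n (t : R) (v : 'rV[R]_n) i :
  row_cons (t, v) ord0 (lift ord0 i) = v ord0 i.
Proof. by rewrite mxE liftK. Qed.

Lemma ge0_integral_prod n (g : 'I_n -> R -> R) :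
  (forall i, measurable_fun setT (g i)) -> (forall i t, (0 <= g i t)%R) ->
  \int[lebesgue_rV R n]_v (\prod_(i < n) g i (v ord0 i))%:E =
  \prod_(i < n) \int[lebesgue_measure]_t (g i t)%:E.
Proof.
elim: n g => [|n IH] g mg g0.
  rewrite big_ord0; under eq_integral do rewrite big_ord0.
  by rewrite integral_cst//= mul1e diracE mem_set.
rewrite ge0_integral_cons; last 2 first.
- by apply/measurable_EFinP; exact: measurable_rV_prod.
- by move=> v; rewrite lee_fin; apply: prodr_ge0.
rewrite big_ord_recl -(IH (fun i => g (lift ord0 i)))//.
rewrite -ge0_integralZr//; last 3 first.
- by apply/measurable_EFinP; exact: mg.
- by move=> t _; rewrite lee_fin.
- by apply: integral_ge0 => v _; rewrite lee_fin prodr_ge0.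
apply: eq_integral => t _.
under eq_integral => v _.
  rewrite big_ord_recl row_cons0.
  under eq_bigr do rewrite row_cons_lift.
  rewrite EFinM; over.
rewrite ge0_integralZl//; last first.
- by rewrite lee_fin.
- by move=> v _; rewrite lee_fin prodr_ge0.
- by apply/measurable_EFinP; exact: (measurable_rV_prod (g := fun i => g (lift ord0 i))).
Qed.

End rV_integrals.

Section complex_rV_integrals.
Context {R : realType}.

Lemma Rintegral_cons n (F : 'rV[R]_n.+1 -> R) :
  (lebesgue_rV R n.+1).-integrable setT (EFin \o F) ->
  \int[lebesgue_rV R n.+1]_v F v =
  \int[(lebesgue_measure \x lebesgue_rV R n)%E]_p F (row_cons p).
Proof.
move=> iF; rewrite /Rintegral; congr fine.
transitivity (\int[pushforward (lebesgue_measure \x lebesgue_rV R n) (@row_cons R n)]_v (F v)%:E)%E.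
  by apply: eq_measure_integral => [|A mA _]; [exact: measurable_row_cons|by []].
rewrite integral_pushforward ?preimage_setT//.
- exact: measurable_row_cons.
- by case/integrableP : iF.
have /integrableP[mF Foo] := iF; apply/integrableP; split.
  by apply: (measurableT_comp mF); exact: measurable_row_cons.
move: Foo; rewrite ge0_integral_cons//; last exact: measurableT_comp.
rewrite fubini_tonelli1//.
by apply: measurableT_comp => //; apply: (measurableT_comp mF); exact: measurable_row_cons.
Qed.

Lemma cintegrable_row_cons n (F : 'rV[R]_n.+1 -> R[i]) :
  cintegrable (lebesgue_rV R n.+1) F ->
  cintegrable (lebesgue_measure \x lebesgue_rV R n)%E (fun p => F (row_cons p)).
Proof.
move=> [mF Foo]; split.
  by apply: (cmeasurableT_comp mF); exact: measurable_row_cons.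
have mN : measurable_fun setT (fun v => (normc (F v))%:E).
  by apply/measurable_EFinP; exact: measurable_normc.
move: Foo; rewrite ge0_integral_cons//; last by move=> v; rewrite lee_fin normc_ge0.
rewrite fubini_tonelli1//; last by move=> v; rewrite lee_fin normc_ge0.
by apply: (measurableT_comp mN); exact: measurable_row_cons.
Qed.

Lemma cint_cons n (F : 'rV[R]_n.+1 -> R[i]) :
  cintegrable (lebesgue_rV R n.+1) F ->
  cint (lebesgue_rV R n.+1) F =
  cint (@lebesgue_measure R) (fun t => cint (lebesgue_rV R n) (fun v => F (row_cons (t, v)))).
Proof.
move=> iF.
rewrite (cint12_prod (f := fun p => F (row_cons p)))//; last exact: cintegrable_row_cons.
by rewrite /cint !Rintegral_cons//; [exact: cintegrable_Im|exact: cintegrable_Re].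
Qed.

Lemma cmeasurable_rV_prod n (g : 'I_n -> R -> R[i]) :
  (forall i, cmeasurable (g i)) ->
  cmeasurable (fun v : 'rV[R]_n => \prod_(i < n) g i (v ord0 i)).
Proof.
move=> mg; apply: cmeasurable_prod => i.
exact: (cmeasurableT_comp (mg i) (measurable_rV_coord i)).
Qed.

Lemma cintegrable_prod n (g : 'I_n -> R -> R[i]) :
  (forall i, cintegrable (@lebesgue_measure R) (g i)) ->
  cintegrable (lebesgue_rV R n) (fun v => \prod_(i < n) g i (v ord0 i)).
Proof.
move=> ig; split.
  by apply: cmeasurable_rV_prod => i; case: (ig i).
under eq_integral do rewrite normc_prod.
rewrite (ge0_integral_prod (g := fun i t => normc (g i t))).
- have Hlt i : (\int[lebesgue_measure]_t (normc (g i t))%:E < +oo)%E.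
    by case: (ig i).
  have Hge i : (0 <= \int[lebesgue_measure]_t (normc (g i t))%:E)%E.
    by apply: integral_ge0 => t _; rewrite lee_fin normc_ge0.
  rewrite (eq_bigr (fun i => (fine (\int[lebesgue_measure]_t (normc (g i t))%:E)%E)%:E)).
    by rewrite prodEFin ltry.
  by move=> i _; rewrite fineK// ge0_fin_numE.
- by move=> i; apply: measurable_normc; case: (ig i).
- by move=> i t; exact: normc_ge0.
Qed.

Lemma cint_prod n (g : 'I_n -> R -> R[i]) :
  (forall i, cintegrable (@lebesgue_measure R) (g i)) ->
  cint (lebesgue_rV R n) (fun v => \prod_(i < n) g i (v ord0 i)) =
  \prod_(i < n) cint (@lebesgue_measure R) (g i).
Proof.
elim: n g => [|n IH] g ig.
  rewrite big_ord0; under eq_fun do rewrite big_ord0.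
  have dT : lebesgue_rV R 0 setT = 1%E by rewrite /= diracE mem_set.
  have H (r : R) : \int[lebesgue_rV R 0]_v r = r.
    rewrite Rintegral_cst// (_ : fine _ = 1) ?mulr1//.
    by change (fine (@dirac _ 'rV[R]_0 0 R setT) = 1); rewrite diracE mem_set.
  by rewrite /cint !H.
rewrite cint_cons; last exact: cintegrable_prod.
rewrite big_ord_recl.
pose C := \prod_(i < n) cint (@lebesgue_measure R) (g (lift ord0 i)).
transitivity (cint (@lebesgue_measure R) (fun t => C * g ord0 t)).
  congr cint; apply/funext => t.
  rewrite /C -IH// mulrC -cintZ; last exact: (cintegrable_prod (fun i => ig (lift ord0 i))).
  congr cint; apply/funext => v.
  rewrite big_ord_recl row_cons0; congr (_ * _).
  by apply: eq_bigr => i _; rewrite row_cons_lift.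
by rewrite cintZ// mulrC.
Qed.

End complex_rV_integrals.

(** * The Poisson kernel as a Fourier transform *)

Section unit_circle.
Context {R : realType}.

Definition cis (a : R) : R[i] := Complex (cos a) (sin a).

Lemma normc_cis a : normc (cis a) = 1.
Proof. by rewrite /cis /= cos2Dsin2 sqrtr1. Qed.

Lemma cis0 : cis 0 = 1.
Proof. by rewrite /cis cos0 sin0. Qed.

Lemma cisD a b : cis (a + b) = cis a * cis b.
Proof. by apply: complex_eq; rewrite /cis ?Re_mul ?Im_mul /= ?cosD ?sinD; ring. Qed.

Lemma cmeasurable_cis d (T : measurableType d) (f : T -> R) :
  measurable_fun setT f -> cmeasurable (fun x => cis (f x)).
Proof.
move=> mf; split; apply: (measurableT_comp _ mf); apply: continuous_measurable_fun.
  exact: continuous_cos.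
exact: continuous_sin.
Qed.

End unit_circle.

Section one_dimensional_kernel.
Context {R : realType}.
Local Notation leb := (@lebesgue_measure R).

(** Evenness reduces the integral to a half-line, so that F need not be
    differentiable at 0: this allows an f that involves |x|. *)
Lemma integral_even_FTC (f F : R -> R) (l : R) :
  (forall x, 0 <= f x) -> continuous f -> (forall x, f (- x) = f x) ->
  (forall x : R, 0 < x -> is_derive x (1 : R) F (f x)) -> {for (0 : R), continuous F} ->
  F x @[x --> +oo%R] --> l ->
  (\int[leb]_x (f x)%:E = (2 * (l - F 0))%:E)%E.
Proof.
move=> f0 cf fN dF cF Fl.
rewrite ge0_symfun_integralT//; last by move=> x /=; rewrite fN.
rewrite EFinM; congr (_ * _)%E.
rewrite -set_itvcy (ge0_continuous_FTC2y _ _ Fl)//.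
- exact: continuous_subspaceT.
- by move=> x x0; case: (dF x x0).
- exact: cvg_at_right_filter.
- move=> x; rewrite in_itv /= andbT => x0; case: (dF x x0) => _ dFx.
  by rewrite derive1E.
Qed.

(** The damping factor of Abel summation. *)
Definition kappa (dl t : R) := expR (- (dl * `|t|)).

Definition poisson (dl z : R) := 2 * dl / (dl ^+ 2 + z ^+ 2).

Variables (dl : R) (dl0 : 0 < dl).

Local Notation kap := (kappa dl).

(** The real part of exp((- dl + i z) t) / (- dl + i z). *)
Let F (z t : R) : R :=
  expR (- dl * t) * ((z * sin (z * t) - dl * cos (z * t)) / (dl ^+ 2 + z ^+ 2)).

Let den_gt0 (z : R) : 0 < dl ^+ 2 + z ^+ 2.
Proof. by rewrite ltr_pwDl ?exprn_gt0 ?sqr_ge0. Qed.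

Let is_derive_F (z t : R) : is_derive t (1 : R) (F z) (expR (- dl * t) * cos (z * t)).
Proof.
have dlin (a : R) : is_derive t (1 : R) (fun t : R => a * t) a.
  have : is_derive t (1 : R) (a \*: (id : R -> R)) (a *: (1 : R)) by exact: is_deriveZ.
  by rewrite /GRing.scale /= mulr1.
have d1 := dlin (- dl).
have De : is_derive t (1 : R) (fun t => expR (- dl * t)) (- dl * expR (- dl * t)).
  by rewrite [X in is_derive _ _ _ X]mulrC; exact: (is_derive1_comp (f := expR)).
have dz := dlin z.
have Ds : is_derive t (1 : R) (fun t => sin (z * t)) (z * cos (z * t)).
  by rewrite [X in is_derive _ _ _ X]mulrC; exact: (is_derive1_comp (f := sin)).
have Dc : is_derive t (1 : R) (fun t => cos (z * t)) (z * - sin (z * t)).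
  by rewrite [X in is_derive _ _ _ X]mulrC; exact: (is_derive1_comp (f := cos)).
have Dn : is_derive t (1 : R)
    ((z \*: (fun t => sin (z * t)) : R -> R) - (dl \*: (fun t => cos (z * t)) : R -> R))
    (z *: (z * cos (z * t)) - dl *: (z * - sin (z * t))).
  exact: is_deriveB.
have Dn' : is_derive t (1 : R) ((dl ^+ 2 + z ^+ 2)^-1 \*: 
    ((z \*: (fun t => sin (z * t)) : R -> R) - (dl \*: (fun t => cos (z * t)) : R -> R)))
    ((dl ^+ 2 + z ^+ 2)^-1 *: (z *: (z * cos (z * t)) - dl *: (z * - sin (z * t)))).
  exact: is_deriveZ.
move: (is_deriveM De Dn').
set G := (X in is_derive _ _ X _); set g := (X in is_derive _ _ _ X).
have -> : G = F z by apply/funext => u; rewrite /F [X in _ = _ * X]mulrC.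
have -> : g = expR (- dl * t) * cos (z * t).
  have d0 := lt0r_neq0 (den_gt0 z).
  change (expR (- dl * t) * ((dl ^+ 2 + z ^+ 2)^-1 *
      (z * (z * cos (z * t)) - dl * (z * - sin (z * t)))) +
    (dl ^+ 2 + z ^+ 2)^-1 * (z * sin (z * t) - dl * cos (z * t)) *
    (- dl * expR (- dl * t)) = expR (- dl * t) * cos (z * t)).
  by field.
by [].
Qed.

Let F_at0 (z : R) : F z 0 = - (dl / (dl ^+ 2 + z ^+ 2)).
Proof. by rewrite /F !mulr0 expR0 sin0 cos0 mulr0 mulr1 sub0r mul1r mulNr. Qed.

Let F_cvg (z : R) : F z t @[t --> +oo%R] --> 0.
Proof.
pose B := (`|z| + dl) / (dl ^+ 2 + z ^+ 2).
have B0 : 0 <= B by rewrite divr_ge0// ?ltW// ltr_wpDl// ltW.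
have E0 : B * expR (- (dl * t)) @[t --> +oo%R] --> 0.
  rewrite -[X in _ --> X](mulr0 B); apply: cvgM; first exact: cvg_cst.
  apply: (@cvg_comp _ _ _ (fun t => dl * t) (fun t => expR (- t)) _ (pinfty_nbhs R)).
    by apply: gt0_cvgMry => //; exact: cvg_id.
  exact: cvgr_expR.
apply/cvgr0Pnorm_lt => e e0.
move/cvgr0Pnorm_lt : E0 => /(_ _ e0); apply: filterS => t.
apply: le_lt_trans; rewrite [leRHS]ger0_norm; last exact: (mulr_ge0 B0 (expR_ge0 _)).
rewrite /F normrM (ger0_norm (expR_ge0 _)) mulrC mulNr ler_pM2r ?expR_gt0//.
rewrite normf_div (gtr0_norm (den_gt0 z)) /B.
apply: ler_wpM2r; first by rewrite invr_ge0 ltW.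
have s1 : `|sin (z * t)| <= 1 by rewrite ler_norml sin_geN1 sin_le1.
have c1 : `|cos (z * t)| <= 1 by rewrite ler_norml cos_geN1 cos_le1.
rewrite (le_trans (ler_normB _ _))// !normrM (gtr0_norm dl0) lerD//.
  by rewrite ler_piMr.
by rewrite ler_piMr// ltW.
Qed.

Let kapN t : kap (- t) = kap t. Proof. by rewrite /kappa normrN. Qed.

Let kap_cont : continuous kap.
Proof.
move=> x; apply: continuous_comp; last exact: continuous_expR.
apply: continuousN; apply: continuousM; first exact: cst_continuous.
exact: norm_continuous.
Qed.

Let cosM_cont (z : R) : continuous (fun t : R => cos (z * t)).
Proof.
move=> x; apply: continuous_comp; last exact: continuous_cos.
exact: mulrl_continuous.
Qed.

(** The fundamental theorem on a half-line is for nonnegative integrands, hence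
    the 1 added to the cosine; the case z = 0 then gives the integral of the
    damping factor alone. *)
Let kap_cos1 (z : R) :
  (\int[leb]_t (kap t * (1 + cos (z * t)))%:E =
   (2 / dl + 2 * dl / (dl ^+ 2 + z ^+ 2))%:E)%E.
Proof.
transitivity ((2 * (0 - (F 0 0 + F z 0)))%:E); last first.
  rewrite !F_at0; congr EFin; have := lt0r_neq0 (den_gt0 z); have := lt0r_neq0 dl0.
  by move=> d1 d2; rewrite expr0n /= addr0; field; rewrite d1 d2.
apply: (@integral_even_FTC (fun t => kap t * (1 + cos (z * t))) (fun t => F 0 t + F z t)).
- move=> t; rewrite mulr_ge0 ?expR_ge0//; have := cos_geN1 (z * t); lra.
- move=> t; apply: continuousM; first exact: kap_cont.
  by apply: continuousD; [exact: cst_continuous|exact: cosM_cont].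
- by move=> t; rewrite kapN mulrN cosN.
- move=> t t0.
  have -> : kap t * (1 + cos (z * t)) =
      expR (- dl * t) * cos (0 * t) + expR (- dl * t) * cos (z * t).
    by rewrite mul0r cos0 mulr1 /kappa gtr0_norm// mulNr mulrDr mulr1.
  exact: (is_deriveD (is_derive_F 0 t) (is_derive_F z t)).
- have Fc w : {for 0, continuous (F w)}.
    apply: differentiable_continuous; apply/derivable1_diffP.
    by case: (is_derive_F w 0).
  by apply: continuousD; exact: Fc.
- by rewrite -[X in _ --> X](addr0 0); apply: cvgD; exact: F_cvg.
Qed.

Lemma measurable_kappa : measurable_fun setT kap.
Proof. by apply: continuous_measurable_fun; exact: kap_cont. Qed.

Lemma kappa_lty : (\int[leb]_t (kap t)%:E < +oo)%E.
Proof.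
apply: le_lt_trans (ltry (2 / dl + 2 * dl / (dl ^+ 2 + 0 ^+ 2))).
rewrite -kap_cos1; apply: ge0_le_intEFin; first exact: measurable_kappa.
  apply: measurable_funM; first exact: measurable_kappa.
  apply: measurable_funD => //.
  by apply: continuous_measurable_fun; exact: cosM_cont.
move=> t; rewrite expR_ge0 mul0r cos0 mulrDr mulr1 lerDl; exact: expR_ge0.
Qed.


Lemma normc_kappa_cis z t :
  normc (real_complex R (kap t) * cis (z * t)) = kap t.
Proof. by rewrite normcM normc_cis mulr1 normc_real ger0_norm ?expR_ge0. Qed.

Lemma cintegrable_kappa (z : R) :
  cintegrable leb (fun t => real_complex R (kap t) * cis (z * t)).
Proof.
split; last by under eq_integral do rewrite normc_kappa_cis; exact: kappa_lty.
apply: cmeasurableM; first by apply: cmeasurable_real; exact: measurable_kappa.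
by apply: cmeasurable_cis; exact: mulrl_measurable.
Qed.

Let Rintegral_opp (g : R -> R) : leb.-integrable setT (EFin \o g) ->
  \int[leb]_t g (- t) = \int[leb]_t g t.
Proof.
move=> ig; have /integrableP[mg goo] := ig; rewrite /Rintegral; congr fine.
have mN : measurable_fun setT (-%R : measurableTypeR R -> measurableTypeR R) by [].
transitivity (\int[pushforward leb (-%R : _ -> measurableTypeR R)]_t (g t)%:E)%E; last first.
  by apply: eq_measure_integral => A mA _; exact: lebesgue_measureN.
rewrite integral_pushforward ?preimage_setT//.
apply/integrableP; split; first exact: (measurableT_comp mg mN).
rewrite -(ge0_integral_pushforward mN leb measurableT (f := fun t => `|(EFin \o g) t|%E)).
- rewrite (eq_measure_integral leb)// => A mA _; exact: lebesgue_measureN.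
- exact: measurableT_comp.
- by move=> ? _.
Qed.

Let lin_aux (A B C P : R) : A + A = B + B -> A + C = B + P -> C = P.
Proof. lra. Qed.

(** The real part follows from the antiderivative above; the imaginary part
    vanishes because its integrand is odd. *)
Lemma cint_kappa (z : R) :
  cint leb (fun t => real_complex R (kap t) * cis (z * t)) =
  real_complex R (poisson dl z).
Proof.
have ik := cintegrable_kappa z.
have icos := cintegrable_Re ik; have isin := cintegrable_Im ik.
have ReE t : complex.Re (real_complex R (kap t) * cis (z * t)) = kap t * cos (z * t).
  by rewrite Re_mul /= mul0r subr0.
have ImE t : complex.Im (real_complex R (kap t) * cis (z * t)) = kap t * sin (z * t).
  by rewrite Im_mul /= mul0r addr0.
apply: complex_eq; rewrite /cint /=.
  have ikap : leb.-integrable setT (EFin \o kap).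
    apply/integrableP; split; first by apply/measurable_EFinP; exact: measurable_kappa.
    by under eq_integral do rewrite /= ger0_norm ?expR_ge0//; exact: kappa_lty.
  have H w : leb.-integrable setT (EFin \o (fun t => kap t * cos (w * t))) ->
      \int[leb]_t kap t + \int[leb]_t (kap t * cos (w * t)) =
      2 / dl + 2 * dl / (dl ^+ 2 + w ^+ 2).
    move=> iw; rewrite -RintegralD// /Rintegral -[RHS]/(fine _%:E) -kap_cos1.
    by congr fine; apply: eq_integral => t _; rewrite mulrDr mulr1.
  have i0 : leb.-integrable setT (EFin \o (fun t => kap t * cos (0 * t))).
    rewrite (_ : _ \o _ = EFin \o kap)//.
    by apply/funext => t /=; rewrite mul0r cos0 mulr1.
  have H0 := H _ i0; rewrite (_ : \int[leb]_t (kap t * cos (0 * t)) = \int[leb]_t kap t) in H0; last first.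
    by apply: eq_Rintegral => t _; rewrite mul0r cos0 mulr1.
  have iz : leb.-integrable setT (EFin \o (fun t => kap t * cos (z * t))).
    by move: icos; apply: eq_integrable => // t _; congr EFin; exact: ReE.
  have Hz := H _ iz.
  have -> : \int[leb]_t complex.Re (real_complex R (kap t) * cis (z * t)) =
      \int[leb]_t (kap t * cos (z * t)) by apply: eq_Rintegral => t _; exact: ReE.
  have E0 : 2 * dl / (dl ^+ 2 + 0 ^+ 2) = 2 / dl.
    by rewrite expr0n /= addr0; field; exact: lt0r_neq0.
  rewrite E0 in H0; rewrite /poisson; exact: (lin_aux H0 Hz).
have iz : leb.-integrable setT (EFin \o (fun t => kap t * sin (z * t))).
  by move: isin; apply: eq_integrable => // t _; congr EFin; exact: ImE.
have -> : \int[leb]_t complex.Im (real_complex R (kap t) * cis (z * t)) =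
    \int[leb]_t (kap t * sin (z * t)) by apply: eq_Rintegral => t _; exact: ImE.
have := Rintegral_opp iz.
have -> : \int[leb]_t (kap (- t) * sin (z * - t)) =
    \int[leb]_t (-1 * (kap t * sin (z * t))).
  by apply: eq_Rintegral => t _; rewrite kapN mulrN sinN mulrN mulN1r.
rewrite RintegralZl// mulN1r => /eqP; rewrite eqNr => /eqP.
exact.
Qed.

Lemma poisson_ge0 z : 0 <= poisson dl z.
Proof. by rewrite /poisson divr_ge0// ?mulr_ge0// ltW. Qed.

Lemma poissonN z : poisson dl (- z) = poisson dl z.
Proof. by rewrite /poisson sqrrN. Qed.

Lemma continuous_poisson : continuous (poisson dl).
Proof.
move=> z; rewrite /continuous_at /poisson; apply: cvgM; first exact: cvg_cst.
apply: cvgV; first exact: lt0r_neq0 (den_gt0 z).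
by apply: cvgD; [exact: cvg_cst|exact: exprn_continuous].
Qed.

Lemma measurable_poisson : measurable_fun setT (poisson dl).
Proof. by apply: continuous_measurable_fun; exact: continuous_poisson. Qed.

Lemma integral_poisson : (\int[leb]_z (poisson dl z)%:E = (2 * pi)%:E)%E.
Proof.
transitivity ((2 * (2 * (pi / 2) - 2 * atan (0 / dl)))%:E); last first.
  by rewrite mul0r atan0 mulr0 subr0; congr EFin; field.
apply: (@integral_even_FTC _ (fun z => 2 * atan (z / dl))).
- exact: poisson_ge0.
- exact: continuous_poisson.
- exact: poissonN.
- move=> z _.
  have d1 : is_derive z (1 : R) (fun z : R => dl^-1 * z) dl^-1.
    have : is_derive z (1 : R) (dl^-1 \*: (id : R -> R)) (dl^-1 *: (1 : R)) by exact: is_deriveZ.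
    by rewrite /GRing.scale /= mulr1.
  have d2 : is_derive z (1 : R) (fun z : R => atan (dl^-1 * z))
      ((1 + (dl^-1 * z) ^+ 2)^-1 * dl^-1).
    exact: (is_derive1_comp (f := atan)).
  have : is_derive z (1 : R) (2 \*: (fun z : R => atan (dl^-1 * z)))
      (2 *: ((1 + (dl^-1 * z) ^+ 2)^-1 * dl^-1)) by exact: is_deriveZ.
  rewrite (_ : 2 *: _ = poisson dl z).
    by rewrite (_ : 2 \*: _ = fun z => 2 * atan (z / dl))//; apply/funext => u; rewrite [u / dl]mulrC.
  rewrite /poisson /GRing.scale /=; field.
  by rewrite (lt0r_neq0 dl0) (lt0r_neq0 (den_gt0 z)).
- rewrite /continuous_at; apply: cvgM; first exact: cvg_cst.
  apply: (@cvg_comp _ _ _ (fun z => z / dl) atan _ (nbhs (0 / dl))); last exact: continuous_atan.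
  by apply: cvgM; [exact: cvg_id|exact: cvg_cst].
- apply: cvgM; first exact: cvg_cst.
  apply: (@cvg_comp _ _ _ (fun z => z / dl) atan _ (pinfty_nbhs R)); last exact: cvgy_atan.
  by apply: gt0_cvgMly; rewrite ?invr_gt0//; exact: cvg_id.
Qed.

End one_dimensional_kernel.

(** * Dot products and the product kernels *)

Section dot_product.
Context {R : realType} (n : nat).
Implicit Types x y z : 'rV[R]_n.

Lemma dotvC x y : dotv x y = dotv y x.
Proof. by apply: eq_bigr => i _; rewrite mulrC. Qed.

Lemma dotvDl x y z : dotv (x + y) z = dotv x z + dotv y z.
Proof. by rewrite /dotv -big_split; apply: eq_bigr => i _; rewrite mxE mulrDl. Qed.

Lemma dotvDr x y z : dotv z (x + y) = dotv z x + dotv z y.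
Proof. by rewrite dotvC dotvDl !(dotvC z). Qed.

Lemma dotvNl x y : dotv (- x) y = - dotv x y.
Proof. by rewrite /dotv -sumrN; apply: eq_bigr => i _; rewrite mxE mulNr. Qed.

Lemma dotvNr x y : dotv x (- y) = - dotv x y.
Proof. by rewrite dotvC dotvNl dotvC. Qed.

Lemma dotv_ge0 x : 0 <= dotv x x.
Proof. by apply: sumr_ge0 => i _; rewrite -expr2 sqr_ge0. Qed.

Lemma enorm_ge0 x : 0 <= enorm x. Proof. exact: sqrtr_ge0. Qed.

Lemma enorm_sqr x : enorm x ^+ 2 = dotv x x.
Proof. by rewrite sqr_sqrtr// dotv_ge0. Qed.

Lemma enormN x : enorm (- x) = enorm x.
Proof. by rewrite /enorm dotvNl dotvNr opprK. Qed.

Lemma dotv_scale (a : R) x y : dotv (a *: x) y = a * dotv x y.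
Proof. by rewrite /dotv mulr_sumr; apply: eq_bigr => i _; rewrite mxE mulrA. Qed.

Lemma enorm_eq0 x : enorm x = 0 -> x = 0.
Proof.
move=> x0; have : dotv x x == 0 by rewrite -enorm_sqr x0 expr0n.
rewrite psumr_eq0; last by move=> i _; rewrite -expr2 sqr_ge0.
move=> /allP h; apply/rowP => i; rewrite mxE.
by have := h i (mem_index_enum i); rewrite /= mulf_eq0 orbb => /eqP.
Qed.

(** Cauchy-Schwarz, from the nonnegativity of the squared norm of
    |y| x - |x| y. *)
Lemma dotv_le_enorm x y : dotv x y <= enorm x * enorm y.
Proof.
have [x0|x0] := eqVneq (enorm x) 0.
  by rewrite (enorm_eq0 x0) /dotv big1 ?mulr_ge0 ?enorm_ge0// => i _; rewrite mxE mul0r.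
have [y0|y0] := eqVneq (enorm y) 0.
  by rewrite (enorm_eq0 y0) /dotv big1 ?mulr_ge0 ?enorm_ge0// => i _; rewrite mxE mulr0.
have ab : 0 < enorm x * enorm y by rewrite mulr_gt0// lt_neqAle eq_sym ?x0 ?y0 enorm_ge0.
have := dotv_ge0 (enorm y *: x - enorm x *: y).
rewrite dotvDl !dotvDr !dotvNl !dotvNr opprK !dotv_scale !(dotvC _ (_ *: _)) !dotv_scale.
rewrite -!enorm_sqr (dotvC y x) => h.
rewrite -(ler_pM2l ab); nra.
Qed.

Lemma enorm_triangle x y : enorm (x + y) <= enorm x + enorm y.
Proof.
rewrite -(@ler_pXn2r _ 2)// ?nnegrE ?addr_ge0 ?enorm_ge0//.
rewrite enorm_sqr dotvDl !dotvDr sqrrD !enorm_sqr (dotvC y x).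
have := dotv_le_enorm x y; lra.
Qed.

Lemma coord_le_enorm x i : `|x ord0 i| <= enorm x.
Proof.
rewrite -(@ler_pXn2r _ 2)// ?nnegrE ?enorm_ge0//.
rewrite enorm_sqr /dotv (bigD1 i)//= real_normK ?num_real// expr2 lerDl.
by apply: sumr_ge0 => j _; rewrite -expr2 sqr_ge0.
Qed.

Lemma cis_dotv x y : cis (dotv x y) = \prod_(i < n) cis (x ord0 i * y ord0 i).
Proof. by rewrite /dotv (big_morph (@cis R) (@cisD R) (@cis0 R)). Qed.

Lemma fourierE f y :
  fourier f y = cint (lebesgue_rV R n) (fun x => f x * cis (- dotv x y)).
Proof.
by rewrite /fourier /cintegral /cint; congr Complex; apply: eq_Rintegral => x _;
  rewrite /cis cosN sinN.
Qed.

Lemma cmeasurable_cis_dotv d (T : measurableType d) (f g : T -> 'rV[R]_n) :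
  measurable_fun setT f -> measurable_fun setT g ->
  cmeasurable (fun t => cis (dotv (f t) (g t))).
Proof. by move=> mf mg; apply: cmeasurable_cis; exact: measurable_dotv. Qed.

End dot_product.

Section product_kernel.
Context {R : realType} (n : nat) (dl : R) (dl0 : 0 < dl).
Local Notation V := 'rV[R]_n.
Local Notation mu := (lebesgue_rV R n).

Definition kappa_rV (dl : R) (y : V) := \prod_(i < n) kappa dl (y ord0 i).
Definition poisson_rV (dl : R) (y : V) := \prod_(i < n) poisson dl (y ord0 i).

Lemma kappa_rV_ge0 y : 0 <= kappa_rV dl y.
Proof. by apply: prodr_ge0 => i _; exact: expR_ge0. Qed.

Lemma kappa_rVE y : kappa_rV dl y = expR (- (dl * \sum_(i < n) `|y ord0 i|)).
Proof. by rewrite mulr_sumr -sumrN expR_sum. Qed.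

Lemma kappa_rV_le1 y : kappa_rV dl y <= 1.
Proof. by rewrite kappa_rVE expR_le1 oppr_le0; apply: mulr_ge0; [exact: ltW|apply: sumr_ge0]. Qed.

Lemma poisson_rV_ge0 y : 0 <= poisson_rV dl y.
Proof. by apply: prodr_ge0 => i _; exact: poisson_ge0. Qed.

Lemma poisson_rVN y : poisson_rV dl (- y) = poisson_rV dl y.
Proof. by apply: eq_bigr => i _; rewrite mxE poissonN. Qed.

Lemma measurable_kappa_rV : measurable_fun setT (kappa_rV dl).
Proof. by apply: (measurable_rV_prod (g := fun=> kappa dl)) => i; exact: measurable_kappa. Qed.

Lemma measurable_poisson_rV : measurable_fun setT (poisson_rV dl).
Proof. by apply: (measurable_rV_prod (g := fun=> poisson dl)) => i; exact: measurable_poisson. Qed.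

Lemma kappa_rV_cisE w y : real_complex R (kappa_rV dl y) * cis (dotv w y) =
  \prod_(i < n) (real_complex R (kappa dl (y ord0 i)) * cis (w ord0 i * y ord0 i)).
Proof. by rewrite big_split /= cis_dotv rmorph_prod. Qed.

Lemma cintegrable_kappa_rV w :
  cintegrable mu (fun y => real_complex R (kappa_rV dl y) * cis (dotv w y)).
Proof.
under eq_fun do rewrite kappa_rV_cisE.
apply: (cintegrable_prod (g := fun i t => real_complex R (kappa dl t) * cis (w ord0 i * t))).
by move=> i; exact: cintegrable_kappa.
Qed.

Lemma cint_kappa_rV w :
  cint mu (fun y => real_complex R (kappa_rV dl y) * cis (dotv w y)) =
  real_complex R (poisson_rV dl w).
Proof.
under eq_fun do rewrite kappa_rV_cisE.
rewrite (cint_prod (g := fun i t => real_complex R (kappa dl t) * cis (w ord0 i * t))).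
  by rewrite rmorph_prod; apply: eq_bigr => i _; exact: cint_kappa.
by move=> i; exact: cintegrable_kappa.
Qed.

Lemma integral_kappa_rV_lty : (\int[mu]_y (kappa_rV dl y)%:E < +oo)%E.
Proof.
have [_] := cintegrable_kappa_rV 0.
by under eq_integral do rewrite normcM normc_cis mulr1 normc_real ger0_norm ?kappa_rV_ge0//.
Qed.

Lemma integral_poisson_rV : (\int[mu]_y (poisson_rV dl y)%:E = ((2 * pi) ^+ n)%:E)%E.
Proof.
rewrite (ge0_integral_prod (g := fun=> poisson dl)).
- under eq_bigr do rewrite integral_poisson//.
  by rewrite prodEFin prodr_const card_ord.
- by move=> i; exact: measurable_poisson.
- by move=> i t; exact: poisson_ge0.
Qed.

End product_kernel.

Section poisson_concentration.
Context {R : realType} (n : nat).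
Local Notation V := 'rV[R]_n.
Local Notation mu := (lebesgue_rV R n).

(** Away from 0 the kernel of width dl is dominated by a small multiple of the
    kernel of width 1, whose integral is known: this replaces an explicit
    evaluation of the tails. *)
Lemma poisson_tail (dl r z : R) : 0 < dl -> 0 < r -> r <= `|z| ->
  poisson dl z <= dl * ((1 + r ^+ 2) / r ^+ 2) * poisson 1 z.
Proof.
move=> dl0 r0 rz.
have rz2 : r ^+ 2 <= z ^+ 2.
  by rewrite -(real_normK (num_real z)) ler_pXn2r// nnegrE ltW.
have r2 : 0 < r ^+ 2 by rewrite exprn_gt0.
have d2 : 0 < dl ^+ 2 by rewrite exprn_gt0.
have z2 : 0 < z ^+ 2 by rewrite (lt_le_trans r2).
rewrite /poisson expr1n mulr1.
have -> : dl * ((1 + r ^+ 2) / r ^+ 2) * (2 / (1 + z ^+ 2)) =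
   (2 * dl) * ((1 + r ^+ 2) / (r ^+ 2 * (1 + z ^+ 2))).
  by field; rewrite (lt0r_neq0 r0) andbT lt0r_neq0 ?addr_gt0.
rewrite ler_pM2l ?mulr_gt0// ler_pdivlMr ?mulr_gt0 ?ltr_pwDl// ?sqr_ge0//.
rewrite mulrC ler_pdivrMr ?addr_gt0//; nra.
Qed.

Let mix (dl : R) (i j : 'I_n) : R -> R := if j == i then poisson 1 else poisson dl.

Let mix_ge0 dl i j t : 0 < dl -> 0 <= mix dl i j t.
Proof. by move=> d0; rewrite /mix; case: ifP => _; exact: poisson_ge0. Qed.

Let measurable_mix dl i j : 0 < dl -> measurable_fun setT (mix dl i j).
Proof. by move=> d0; rewrite /mix; case: ifP => _; exact: measurable_poisson. Qed.

Let integral_mix dl i : 0 < dl ->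
  (\int[mu]_z (\prod_(j < n) mix dl i j (z ord0 j))%:E = ((2 * pi) ^+ n)%:E)%E.
Proof.
move=> d0; rewrite (ge0_integral_prod (g := mix dl i)).
- rewrite (eq_bigr (fun=> (2 * pi)%:E)); first by rewrite prodEFin prodr_const card_ord.
  by move=> j _; rewrite /mix; case: ifP => _; rewrite integral_poisson//.
- by move=> j; exact: measurable_mix.
- by move=> j t; exact: mix_ge0.
Qed.

(** Where coordinate i of z is at least r in modulus, the kernel is at most a
    multiple of dl times the product kernel of width 1 in coordinate i and dl
    in the others, which still has mass (2 pi)^n. *)
Lemma poisson_rV_concentrate (dl r e M : R) (g : V -> R) :
  0 < dl -> 0 < r -> 0 <= e -> measurable_fun setT g ->
  (forall z, 0 <= g z <= M) -> (forall z : V, (forall i, `|z ord0 i| < r) -> g z <= e) ->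
  (\int[mu]_z (g z * poisson_rV dl z)%:E <=
  ((e + M * (dl * ((1 + r ^+ 2) / r ^+ 2)) * n%:R) * (2 * pi) ^+ n)%:E)%E.
Proof.
move=> d0 r0 e0 mg gM ge.
set C := dl * _.
have C0 : 0 <= C.
  rewrite /C; apply: mulr_ge0; first exact: ltW.
  by apply: divr_ge0; rewrite ?sqr_ge0//; apply: addr_ge0; rewrite ?sqr_ge0.
have M0 : 0 <= M by case/andP: (gM 0); exact: le_trans.
pose T i (z : V) := \prod_(j < n) mix dl i j (z ord0 j).
have T0 i z : 0 <= T i z by apply: prodr_ge0 => j _; exact: mix_ge0.
have mT i : measurable_fun setT (T i).
  by apply: (measurable_rV_prod (g := mix dl i)) => j; exact: measurable_mix.
apply: (@le_trans _ _ (\int[mu]_z (e * poisson_rV dl z + (M * C) * \sum_i T i z)%:E)%E).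
  apply: ge0_le_intEFin.
  - by apply: measurable_funM => //; exact: measurable_poisson_rV.
  - apply: measurable_funD; first by apply: measurable_funM => //; exact: measurable_poisson_rV.
    by apply: measurable_funM => //; exact: measurable_sum.
  - move=> z; have /andP[g0 gz] := gM z; have P0 := poisson_rV_ge0 d0 z.
    rewrite mulr_ge0//=.
    have S0 : 0 <= \sum_i T i z by apply: sumr_ge0.
    have [zr|] := boolP [forall i, `|z ord0 i| < r].
      rewrite -[leLHS]addr0 lerD//; last exact: (mulr_ge0 (mulr_ge0 M0 C0) S0).
      by rewrite ler_wpM2r// ge// => i; move/forallP : zr.
    rewrite negb_forall => /(elimT existsP)[i rz]; rewrite -leNgt in rz.
    rewrite -[leLHS]add0r lerD//; first by rewrite mulr_ge0.
    rewrite (@le_trans _ _ (M * poisson_rV dl z))//; first by rewrite ler_wpM2r.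
    rewrite -mulrA ler_wpM2l//.
    rewrite (@le_trans _ _ (C * T i z))//; last first.
      by rewrite ler_wpM2l// (bigD1 i)//= lerDl sumr_ge0.
    rewrite /poisson_rV /T (bigD1 i)//= [X in C * X](bigD1 i)//= mulrA.
    rewrite [mix dl i i]/mix eqxx ler_pM//.
    + exact: poisson_ge0.
    + by apply: prodr_ge0 => j _; exact: poisson_ge0.
    + exact: poisson_tail.
    + by apply: ler_prod => j /negbTE ji; rewrite /mix ji lexx andbT poisson_ge0.
under eq_integral do rewrite EFinD EFinM.
rewrite ge0_integralD//; last 4 first.
- by move=> z _; rewrite -EFinM lee_fin mulr_ge0// poisson_rV_ge0.
- apply/measurable_EFinP; apply: measurable_funM => //; exact: measurable_poisson_rV.
- by move=> z _; rewrite lee_fin; apply: mulr_ge0; [exact: mulr_ge0|apply: sumr_ge0].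
- by apply/measurable_EFinP; apply: measurable_funM => //; exact: measurable_sum.
rewrite ge0_integralZl//; last 2 first.
- by apply/measurable_EFinP; exact: measurable_poisson_rV.
- by move=> z _; rewrite lee_fin poisson_rV_ge0.
rewrite integral_poisson_rV//.
under [X in (_ + X <= _)%E]eq_integral do rewrite EFinM -sumEFin.
rewrite ge0_integralZl//; last 3 first.
- by apply: emeasurable_sum => i; exact/measurable_EFinP.
- by move=> z _; rewrite sume_ge0// => i _; rewrite lee_fin.
- by rewrite lee_fin mulr_ge0.
rewrite ge0_integral_sum//; last 2 first.
- by move=> i; exact/measurable_EFinP.
- by move=> i z _; rewrite lee_fin.
under eq_bigr do rewrite integral_mix//.
rewrite sumEFin sumr_const card_ord -!EFinM -EFinD lee_fin.
set P := (2 * pi) ^+ n; rewrite -(mulr_natr P n); set N := n%:R.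
by rewrite (_ : (e + M * C * N) * P = e * P + M * C * (P * N)) ?lexx//; ring.
Qed.

End poisson_concentration.

(** * Fourier inversion *)

Section fourier_transform.
Context {R : realType} (n : nat).
Local Notation V := 'rV[R]_n.
Local Notation mu := (lebesgue_rV R n).
Implicit Types f g : V -> R[i].

Lemma cmeasurable_fourier f : cmeasurable f -> cmeasurable (fourier f).
Proof.
move=> mf; rewrite (_ : fourier f =
    fun y => cint mu (fun x => f x * cis (- dotv x y))).
  apply: (cmeasurable_cint mu (f := fun p : V * V => f p.2 * cis (- dotv p.2 p.1))).
  apply: cmeasurableM; first by apply: (cmeasurableT_comp mf); exact: measurable_snd.
  apply: cmeasurable_cis; apply: measurable_funN.
  by apply: measurable_dotv; [exact: measurable_snd|exact: measurable_fst].
by apply/funext => y; rewrite fourierE.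
Qed.

Lemma measurable_normc_fourier f : cmeasurable f ->
  measurable_fun setT (fun y => normc (fourier f y)).
Proof. by move=> mf; apply: measurable_normc; exact: cmeasurable_fourier. Qed.

Lemma cintegrable_cis f (a : V -> R) : measurable_fun setT a ->
  cintegrable mu f -> cintegrable mu (fun x => f x * cis (a x)).
Proof.
move=> ma [mf foo]; split.
  by apply: cmeasurableM => //; exact: cmeasurable_cis.
by under eq_integral do rewrite normcM normc_cis mulr1.
Qed.

Lemma cintegrable_fourier_integrand f y : cintegrable mu f ->
  cintegrable mu (fun x => f x * cis (- dotv x y)).
Proof.
apply: cintegrable_cis; apply: measurable_funN.
by apply: measurable_dotv => //; exact: measurable_cst.
Qed.

Lemma integral_poisson_rV_translate (dl : R) (x : V) : 0 < dl ->
  (\int[mu]_y (poisson_rV dl (y - x))%:E = ((2 * pi) ^+ n)%:E)%E.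
Proof.
move=> d0; rewrite -(integral_poisson_rV n d0).
apply: (ge0_integral_translation (- x) (F := fun y => (poisson_rV dl y)%:E)).
  by apply/measurable_EFinP; exact: measurable_poisson_rV.
by move=> y; rewrite lee_fin poisson_rV_ge0.
Qed.

(** Damping makes the double integral of f u exp(i <x - u, y>) absolutely
    convergent, so that the integration in y can be done first. *)
Lemma abel_mean_fourier f (x : V) (dl : R) : 0 < dl -> cintegrable mu f ->
  cint mu (fun y => fourier f y * (real_complex R (kappa_rV dl y) * cis (dotv x y))) =
  cint mu (fun u => f u * real_complex R (poisson_rV dl (u - x))).
Proof.
move=> d0 [mf foo].
pose F (p : V * V) : R[i] :=
  f p.2 * (real_complex R (kappa_rV dl p.1) * cis (dotv (x - p.2) p.1)).
have mF : cmeasurable F.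
  apply: cmeasurableM; first by apply: (cmeasurableT_comp mf); exact: measurable_snd.
  apply: cmeasurableM.
    apply: cmeasurable_real; apply: (measurableT_comp (measurable_kappa_rV dl)).
    exact: measurable_fst.
  apply: cmeasurable_cis_dotv; last exact: measurable_fst.
  apply: measurable_fun_rV => i; under eq_fun do rewrite !mxE.
  apply: measurable_funB; first exact: measurable_cst.
  by apply: (measurableT_comp (measurable_rV_coord i)); exact: measurable_snd.
have nF p : normc (F p) = normc (f p.2) * kappa_rV dl p.1.
  by rewrite /F !normcM normc_cis mulr1 normc_real ger0_norm ?kappa_rV_ge0.
transitivity (cint mu (fun y => cint mu (fun u => F (y, u)))).
  congr cint; apply/funext => y; rewrite fourierE mulrC -cintZ; last first.
    exact: cintegrable_fourier_integrand.
  congr cint; apply/funext => u; rewrite /F /= dotvDl dotvNl cisD; ring.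
rewrite cint_fubini//; last first.
  under eq_integral do under eq_integral do rewrite nF /= mulrC EFinM.
  under eq_integral => y _.
    rewrite ge0_integralZl//; last 3 first.
    - by apply/measurable_EFinP; exact: measurable_normc.
    - by move=> u _; rewrite lee_fin normc_ge0.
    - by rewrite lee_fin kappa_rV_ge0.
    over.
  rewrite ge0_integralZr//; last 3 first.
  - by apply/measurable_EFinP; exact: measurable_kappa_rV.
  - by move=> y _; rewrite lee_fin kappa_rV_ge0.
  - by apply: integral_ge0 => u _; rewrite lee_fin normc_ge0.
  rewrite lte_mul_pinfty//.
    by apply: integral_ge0 => u _; rewrite lee_fin kappa_rV_ge0.
  by rewrite ge0_fin_numE ?integral_kappa_rV_lty// integral_ge0// => u _; rewrite lee_fin kappa_rV_ge0.
congr cint; apply/funext => u.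
rewrite /F /= cintZ; last exact: cintegrable_kappa_rV.
by rewrite cint_kappa_rV// -opprB poisson_rVN.
Qed.

End fourier_transform.

Section fourier_inversion.
Context {R : realType} (n : nat).
Local Notation V := 'rV[R]_n.
Local Notation mu := (lebesgue_rV R n).
Implicit Types f g : V -> R[i].
Local Notation c := ((2 * pi) ^+ n : R).

Let c_gt0 : 0 < c.
Proof. by rewrite exprn_gt0// mulr_gt0// pi_gt0. Qed.

Section inversion_at_a_point.
Variables (f : V -> R[i]) (M : R) (x : V).
Hypothesis fi : cintegrable mu f.
Hypothesis fM : forall y, normc (f y) <= M.
Hypothesis fhati : cintegrable mu (fourier f).

Let A (dl : R) :=
  cint mu (fun y => fourier f y * (real_complex R (kappa_rV dl y) * cis (dotv x y))).
Let A0 := cint mu (fun y => fourier f y * cis (dotv x y)).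

Let cint_poisson dl : 0 < dl ->
  cintegrable mu (fun u => f x * real_complex R (poisson_rV dl (u - x))) /\
  cint mu (fun u => f x * real_complex R (poisson_rV dl (u - x))) =
  real_complex R c * f x.
Proof.
move=> d0.
have Pi : cintegrable mu (fun u => real_complex R (poisson_rV dl (u - x))).
  split.
    apply: cmeasurable_real; apply: (measurableT_comp (measurable_poisson_rV d0)).
    exact: measurable_rV_addr.
  under eq_integral do rewrite normc_real ger0_norm ?poisson_rV_ge0//.
  by rewrite integral_poisson_rV_translate// ltry.
split; first exact: cintegrableZ.
rewrite cintZ// mulrC; congr (_ * _).
by rewrite /cint /Rintegral /= integral_poisson_rV_translate// integral0.
Qed.

(** The Poisson kernel centred at x has mass (2 pi)^n, so the difference is the
    integral of (f u - f x) against it, to which concentration applies. *)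
Let abel_mean_dist dl r e : 0 < dl -> 0 < r -> 0 < e ->
  (forall y : V, (forall i, `|y ord0 i - x ord0 i| < r) -> normc (f y - f x) < e) ->
  normc (A dl - real_complex R c * f x) <=
  (e + (M + M) * (dl * ((1 + r ^+ 2) / r ^+ 2)) * n%:R) * c.
Proof.
move=> d0 r0 e0 xr; rewrite /A abel_mean_fourier//.
have [Pi <-] := cint_poisson d0.
have mP : measurable_fun setT (fun u : V => poisson_rV dl (u - x)).
  by apply: (measurableT_comp (measurable_poisson_rV d0)); exact: measurable_rV_addr.
have fPi : cintegrable mu (fun u => f u * real_complex R (poisson_rV dl (u - x))).
  apply: (@cintegrable_le _ _ _ _ _ (fun u : V => M * poisson_rV dl (u - x))).
  - by apply: cmeasurableM; [case: fi|exact: cmeasurable_real].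
  - exact: measurable_funM.
  - under eq_integral do rewrite EFinM.
    rewrite ge0_integralZl//.
    + by rewrite integral_poisson_rV_translate// -EFinM ltry.
    + exact/measurable_EFinP.
    + by move=> u _; rewrite lee_fin poisson_rV_ge0.
    + by rewrite lee_fin (le_trans (normc_ge0 (f 0))).
  - move=> u; rewrite normcM normc_real ger0_norm ?poisson_rV_ge0//.
    by rewrite ler_wpM2r ?poisson_rV_ge0.
rewrite -cintN// -cintD//; last exact: cintegrableN.
apply: normc_cint_le_bound; first by apply: cintegrableD => //; exact: cintegrableN.
pose g (u : V) := normc (f (u + x) - f x).
rewrite (eq_integral (fun u : V => (g (u - x) * poisson_rV dl (u - x))%:E)); last first.
  move=> u _; rewrite /g subrK -mulrBl normcM normc_real ger0_norm//.
  by rewrite poisson_rV_ge0.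
have mg : measurable_fun setT g.
  apply: measurable_normc; apply: cmeasurableD; last exact: cmeasurable_cst.
  by apply: cmeasurableT_comp; [case: fi|exact: measurable_rV_addr].
rewrite (ge0_integral_translation (- x) (F := fun u : V => (g u * poisson_rV dl u)%:E)).
- apply: poisson_rV_concentrate => //; first exact: ltW.
  + move=> u; rewrite /g normc_ge0 (le_trans (normc_le_add _ _))// normc_opp.
    by rewrite lerD.
  + by move=> u ur; apply: ltW; apply: xr => i; rewrite mxE addrK.
- by apply/measurable_EFinP; apply: measurable_funM => //; exact: measurable_poisson_rV.
- by move=> u; rewrite lee_fin mulr_ge0 ?normc_ge0 ?poisson_rV_ge0.
Qed.

(** A bound on the effect of the damping of width 1/(k+1), which tends to 0 by
    dominated convergence. *)
Let b (k : nat) : \bar R :=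
  (\int[mu]_y (normc (fourier f y) * (1 - kappa_rV (harmonic k) y))%:E)%E.

Let harmonic0 k : 0 < harmonic k :> R. Proof. by rewrite /harmonic /= invr_gt0. Qed.

Let b_cvg : b @ \oo --> 0%E.
Proof.
have [mfh _] := fhati.
have mk dl : measurable_fun setT (fun y : V => 1 - kappa_rV dl y).
  by apply: measurable_funB => //; exact: measurable_kappa_rV.
have mn := measurable_normc mfh.
have [] := @dominated_convergence _ _ _ mu setT measurableT
  (fun k y => (normc (fourier f y) * (1 - kappa_rV (harmonic k) y))%:E) (fun=> 0%E)
  (fun y => (normc (fourier f y))%:E).
- by move=> k; apply/measurable_EFinP; exact: measurable_funM.
- exact: measurable_cst.
- apply: aeW => y _; apply: cvg_EFin; first exact: nearW.
  rewrite [X in _ --> X](_ : 0 = normc (fourier f y) * (1 - expR (- (0 * \sum_(i < n) `|y ord0 i|)))); last first.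
    by rewrite mul0r oppr0 expR0 subrr mulr0.
  rewrite (_ : _ \o _ = fun k => normc (fourier f y) *
      (1 - expR (- (harmonic k * \sum_(i < n) `|y ord0 i|)))); last first.
    by apply/funext => k /=; rewrite kappa_rVE.
  apply: cvgM; first exact: cvg_cst.
  apply: cvgB; first exact: cvg_cst.
  apply: continuous_cvg; first exact: continuous_expR.
  by apply: cvgN; apply: cvgM; [exact: cvg_harmonic|exact: cvg_cst].
- exact: cintegrable_normc.
- apply: aeW => y k _.
  rewrite gee0_abs; rewrite lee_fin; last first.
    by rewrite mulr_ge0 ?normc_ge0// subr_ge0 kappa_rV_le1.
  by rewrite ler_piMr ?normc_ge0// gerBl kappa_rV_ge0.
- by move=> _ _; rewrite integral0.
Qed.

Let b_fin k : b k \is a fin_num.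
Proof.
have [mfh fhoo] := fhati.
rewrite ge0_fin_numE; last first.
  apply: integral_ge0 => y _; rewrite lee_fin mulr_ge0 ?normc_ge0// subr_ge0.
  exact: kappa_rV_le1.
apply: le_lt_trans fhoo; apply: ge0_le_intEFin.
- apply: measurable_funM; first exact: measurable_normc.
  by apply: measurable_funB => //; exact: measurable_kappa_rV.
- exact: measurable_normc.
- move=> y; rewrite mulr_ge0 ?normc_ge0 ?subr_ge0 ?kappa_rV_le1//=.
  by rewrite ler_piMr ?normc_ge0// gerBl kappa_rV_ge0.
Qed.

Let A_A0 k : normc (A0 - A (harmonic k)) <= fine (b k).
Proof.
have mdx : measurable_fun setT (fun y : V => dotv x y).
  by apply: measurable_dotv => //; exact: measurable_cst.
have i0 := cintegrable_cis mdx fhati.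
have i1 : cintegrable mu (fun y => fourier f y * (real_complex R (kappa_rV (harmonic k) y) * cis (dotv x y))).
  have [mfh fhoo] := fhati.
  apply: (cintegrable_le (g := fun y => normc (fourier f y))) => //.
  - apply: cmeasurableM => //; apply: cmeasurableM; last exact: cmeasurable_cis.
    by apply: cmeasurable_real; exact: measurable_kappa_rV.
  - exact: measurable_normc.
  - move=> y; rewrite normcM ler_piMr ?normc_ge0// normcM normc_cis mulr1 normc_real.
    by rewrite ger0_norm ?kappa_rV_ge0 ?kappa_rV_le1.
rewrite /A0 /A -cintN// -cintD//; last exact: cintegrableN.
apply: normc_cint_le_bound; first by apply: cintegrableD => //; exact: cintegrableN.
rewrite fineK ?b_fin// /b (eq_integral (fun y => (normc (fourier f y) *
    (1 - kappa_rV (harmonic k) y))%:E))// => y _; congr EFin.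
rewrite (_ : _ + _ = fourier f y *
    (real_complex R (1 - kappa_rV (harmonic k) y) * cis (dotv x y))); last first.
  by rewrite rmorphB rmorph1; ring.
rewrite normcM normcM normc_cis mulr1 normc_real ger0_norm//.
by rewrite subr_ge0 kappa_rV_le1.
Qed.

(** The damped integrals tend to the undamped one as the width tends to 0, and
    also to (2 pi)^n f x. *)
Lemma fourier_inversion :
  (forall e, 0 < e -> exists2 r : R, 0 < r & forall y : V,
    (forall i, `|y ord0 i - x ord0 i| < r) -> normc (f y - f x) < e) ->
  cint mu (fun y => fourier f y * cis (dotv x y)) = real_complex R c * f x.
Proof.
move=> fx; apply/eqP; rewrite -subr_eq0; apply/eqP/eq0_normc/eqP.
rewrite eq_le normc_ge0 andbT; apply/ler_addgt0Pr => e e0; rewrite add0r.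
have [r r0 xr] := fx (e / c) (divr_gt0 e0 c_gt0).
pose C := (M + M) * ((1 + r ^+ 2) / r ^+ 2) * n%:R.
have : (fine \o b) k + (e / c + C * harmonic k) * c @[k --> \oo] --> e.
  rewrite [X in _ --> X](_ : e = 0 + (e / c + C * 0) * c); last first.
    by rewrite mulr0 addr0 add0r divfK// lt0r_neq0.
  apply: cvgD; first exact: fine_cvg b_cvg.
  apply: cvgM; last exact: cvg_cst.
  apply: cvgD; first exact: cvg_cst.
  by apply: cvgM; [exact: cvg_cst|exact: cvg_harmonic].
move/cvgr_to_ge; apply; apply: nearW => k.
rewrite -/A0 -(subrK (A (harmonic k)) A0) -addrA (le_trans (normc_le_add _ _))//.
rewrite lerD//.
rewrite (le_trans (abel_mean_dist _ r0 _ xr))// ?divr_gt0// ler_wpM2r ?(ltW c_gt0)//.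
have hE : e / c + C * harmonic k = e / c + (M + M) * (harmonic k * ((1 + r ^+ 2) / r ^+ 2)) * n%:R.
  by rewrite /C; ring.
by rewrite hE.
Qed.

End inversion_at_a_point.
End fourier_inversion.

(** * Weighted norms of products *)

Section weights.
Context {R : realType} (n : nat) (om : R -> R).
Hypothesis om_weight : weight om.
Local Notation V := 'rV[R]_n.

Lemma weight_enorm_ge0 (y : V) : 0 <= om (enorm y).
Proof. exact/(weight_ge0 om_weight)/enorm_ge0. Qed.

Lemma weight_enormD (x y : V) : om (enorm (x + y)) <= om (enorm x) + om (enorm y).
Proof.
apply: le_trans (weight_subadditive om_weight (enorm_ge0 x) (enorm_ge0 y)).
by apply: (weight_nondecreasing om_weight); [exact: enorm_ge0|exact: enorm_triangle].
Qed.

(** A weight is monotone only on the half-line; composing with the positive part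
    gives a monotone, hence measurable, function of the whole line. *)
Lemma measurable_weight_enorm (l : R) :
  measurable_fun setT (fun y : V => expR (l * om (enorm y))).
Proof.
apply: (measurableT_comp (f := @expR R)) => //; apply: measurable_funM => //.
rewrite (_ : (fun y => _) = (fun t => om (Num.max 0 t)) \o @enorm R n).
  apply: measurableT_comp; last exact: measurable_enorm.
  apply: nondecreasing_measurable => // s t st.
  apply: (weight_nondecreasing om_weight); first by rewrite le_max lexx.
  by rewrite ge_max !le_max lexx st orbT.
by apply/funext => y /=; rewrite (max_idPr (enorm_ge0 y)).
Qed.

Lemma expR_weight_enormD (l : R) (x y : V) : 0 <= l ->
  expR (l * om (enorm (x + y))) <= expR (l * om (enorm x)) * expR (l * om (enorm y)).
Proof. by move=> l0; rewrite -expRD ler_expR -mulrDr ler_wpM2l// weight_enormD. Qed.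

End weights.

Section product_estimate.
Context {R : realType} (n : nat).
Local Notation V := 'rV[R]_n.
Local Notation mu := (lebesgue_rV R n).
Local Notation c := ((2 * pi) ^+ n : R).

Lemma normc_fourier_le (f : V -> R[i]) y : cintegrable mu f ->
  normc (fourier f y) <= fine (\int[mu]_x (normc (f x))%:E)%E.
Proof.
move=> fi; rewrite fourierE; apply: normc_cint_le_bound.
  exact: cintegrable_fourier_integrand.
rewrite fineK; last exact: (integrable_fin_num measurableT (cintegrable_normc fi)).
by under eq_integral do rewrite normcM normc_cis mulr1.
Qed.

(** Writing g as its inversion integral and exchanging integrals exhibits the
    transform of f g as a convolution. *)
Lemma fourier_mul_le (f g : V -> R[i]) (M : R) (y : V) :
  cintegrable mu f -> cintegrable mu g -> cintegrable mu (fun x => f x * g x) ->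
  (forall x, normc (g x) <= M) ->
  continuous (g : V -> R[i]^o) ->
  cintegrable mu (fourier g) ->
  ((c * normc (fourier (fun x => f x * g x) y))%:E <=
   \int[mu]_z (normc (fourier g z) * normc (fourier f (y - z)))%:E)%E.
Proof.
move=> fi gi fgi gM gc ghi.
have c0 : 0 < c by rewrite exprn_gt0// mulr_gt0// pi_gt0.
have [mf foo] := fi; have [mgh ghoo] := ghi.
have msub : measurable_fun setT (fun z : V => y - z).
  apply: measurable_fun_rV => i; under eq_fun do rewrite !mxE.
  by apply: measurable_funB; [exact: measurable_cst|exact: measurable_rV_coord].
have mfh : cmeasurable (fun z : V => fourier f (y - z)).
  by apply: (cmeasurableT_comp (cmeasurable_fourier mf)).
have hi : cintegrable mu (fun z : V => fourier g z * fourier f (y - z)).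
  pose B := fine (\int[mu]_x (normc (f x))%:E)%E.
  apply: (@cintegrable_le _ _ _ _ _ (fun z : V => B * normc (fourier g z))).
  - exact: cmeasurableM.
  - by apply: measurable_funM => //; exact: measurable_normc.
  - have B0 : 0 <= B by rewrite fine_ge0// integral_ge0// => x _; rewrite lee_fin normc_ge0.
    under eq_integral do rewrite EFinM.
    rewrite ge0_integralZl//.
    + by rewrite lte_mul_pinfty.
    + by apply/measurable_EFinP; exact: measurable_normc.
    + by move=> u _; rewrite lee_fin normc_ge0.
  - by move=> z; rewrite normcM mulrC ler_wpM2r ?normc_ge0// normc_fourier_le.
pose F (p : V * V) : R[i] :=
  (f p.1 * cis (- dotv p.1 y)) * (fourier g p.2 * cis (dotv p.1 p.2)).
have mF : cmeasurable F.
  apply: cmeasurableM; apply: cmeasurableM.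
  - by apply: (cmeasurableT_comp mf); exact: measurable_fst.
  - apply: cmeasurable_cis; apply: measurable_funN.
    by apply: measurable_dotv; [exact: measurable_fst|exact: measurable_cst].
  - by apply: (cmeasurableT_comp mgh); exact: measurable_snd.
  - by apply: cmeasurable_cis_dotv; [exact: measurable_fst|exact: measurable_snd].
have nF x z : normc (F (x, z)) = normc (f x) * normc (fourier g z).
  by rewrite /F !normcM !normc_cis !mulr1.
have -> : c * normc (fourier (fun x => f x * g x) y) =
    normc (cint mu (fun z : V => fourier g z * fourier f (y - z))).
  rewrite -[in LHS](ger0_norm (ltW c0)) -normc_real -normcM; congr normc.
  rewrite fourierE -cintZ; last exact: cintegrable_fourier_integrand.
  transitivity (cint mu (fun x => cint mu (fun z : V => F (x, z)))).
    congr cint; apply/funext => x.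
    rewrite /F /= cintZ; last first.
      by apply: cintegrable_cis => //; apply: measurable_dotv => //; exact: measurable_cst.
    rewrite (fourier_inversion (f := g) (M := M))//; first by ring.
    by move=> e e0; exact: continuous_complex_rV.
  rewrite cint_fubini//; last first.
    under eq_integral do under eq_integral do rewrite nF EFinM.
    under eq_integral => x _.
      rewrite ge0_integralZl//; last 3 first.
      - by apply/measurable_EFinP; exact: measurable_normc.
      - by move=> u _; rewrite lee_fin normc_ge0.
      - by rewrite lee_fin normc_ge0.
      over.
    rewrite ge0_integralZr//; last 3 first.
    - by apply/measurable_EFinP; exact: measurable_normc.
    - by move=> u _; rewrite lee_fin normc_ge0.
    - by apply: integral_ge0 => u _; rewrite lee_fin normc_ge0.
    rewrite lte_mul_pinfty//; first by apply: integral_ge0 => u _; rewrite lee_fin normc_ge0.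
    by rewrite ge0_fin_numE// integral_ge0// => u _; rewrite lee_fin normc_ge0.
  congr cint; apply/funext => z; rewrite (fourierE f) -cintZ; last first.
    exact: cintegrable_fourier_integrand.
  congr cint; apply/funext => x; rewrite /F /= dotvDr dotvNr opprD opprK cisD; ring.
apply: le_trans (normc_cint_le hi) _.
by under eq_integral do rewrite normcM.
Qed.

Lemma fourier_norm_ge0 om l (f : V -> R[i]) : (0 <= fourier_norm om l f)%E.
Proof. by apply: integral_ge0 => y _; rewrite lee_fin mulr_ge0 ?normc_ge0 ?expR_ge0. Qed.

(** With the weight split as om |y| <= om |z| + om |y - z|, Tonelli's theorem and
    translation invariance factor the integral of the convolution. *)
Lemma fourier_norm_mul_le (om : R -> R) (l : R) (f g : V -> R[i]) (M : R) :
  weight om -> 0 <= l ->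
  cintegrable mu f -> cintegrable mu g -> cintegrable mu (fun x => f x * g x) ->
  (forall x, normc (g x) <= M) ->
  continuous (g : V -> R[i]^o) ->
  cintegrable mu (fourier g) ->
  (c%:E * fourier_norm om l (fun x => f x * g x)%R <=
   fourier_norm om l g * fourier_norm om l f)%E.
Proof.
move=> omw l0 fi gi fgi gM gc ghi.
have c0 : 0 < c by rewrite exprn_gt0// mulr_gt0// pi_gt0.
pose W (y : V) := expR (l * om (enorm y)).
have mW : measurable_fun setT W by exact: measurable_weight_enorm.
have W0 y : 0 <= W y by exact: expR_ge0.
have mn h : cintegrable mu h -> measurable_fun setT (fun y : V => normc (fourier h y)).
  by move=> [mh _]; exact: measurable_normc_fourier.
pose P (p : V * V) := (normc (fourier g p.2) * W p.2) *
  (normc (fourier f (p.1 - p.2)) * W (p.1 - p.2)).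
have P0 p : 0 <= P p by rewrite !mulr_ge0 ?normc_ge0.
have PE y z : P (y, z) = (normc (fourier g z) * W z) *
  (normc (fourier f (y - z)) * W (y - z)) by [].
have msub2 : measurable_fun setT (fun p : V * V => p.1 - p.2).
  apply: measurable_fun_rV => i; under eq_fun do rewrite !mxE.
  by apply: measurable_funB; apply: (measurableT_comp (measurable_rV_coord i));
    [exact: measurable_fst|exact: measurable_snd].
have mP : measurable_fun setT P.
  apply: measurable_funM.
    apply: (measurableT_comp (f := fun y : V => normc (fourier g y) * W y)).
      by apply: measurable_funM => //; exact: mn.
    exact: measurable_snd.
  apply: (measurableT_comp (f := fun y : V => normc (fourier f y) * W y)) => //.
  by apply: measurable_funM => //; exact: mn.
rewrite /fourier_norm -ge0_integralZl//; last 3 first.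
- by apply/measurable_EFinP; apply: measurable_funM => //; exact: mn.
- by move=> y _; rewrite lee_fin mulr_ge0 ?normc_ge0 ?expR_ge0.
- by rewrite lee_fin ltW.
apply: (@le_trans _ _ (\int[mu]_y \int[mu]_z (P (y, z))%:E)%E).
  apply: ge0_le_integral => //.
  - by move=> y _; rewrite -EFinM lee_fin !mulr_ge0 ?normc_ge0 ?expR_ge0// ltW.
  - by apply: measurable_funeM; apply/measurable_EFinP; apply: measurable_funM => //; exact: mn.
  - apply: (measurable_fun_fubini_tonelli_F (fun p : V * V => (P p)%:E)) => //.
    exact/measurable_EFinP.
  move=> y _.
  rewrite -EFinM mulrA EFinM muleC.
  apply: (@le_trans _ _ ((W y)%:E * (\int[mu]_z (normc (fourier g z) * normc (fourier f (y - z)))%:E))%E).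
    by apply: lee_wpmul2l; [rewrite lee_fin|exact: (fourier_mul_le _ _ _ _ gM)].
  have msub : measurable_fun setT (fun z : V => y - z).
    apply: measurable_fun_rV => i; under eq_fun do rewrite !mxE.
    by apply: measurable_funB; [exact: measurable_cst|exact: measurable_rV_coord].
  rewrite -ge0_integralZl//; last 3 first.
  - apply/measurable_EFinP; apply: measurable_funM; first exact: mn.
    by apply: (measurableT_comp (mn _ fi)).
  - by move=> z _; rewrite lee_fin mulr_ge0 ?normc_ge0.
  - by rewrite lee_fin.
  under eq_integral do rewrite -EFinM.
  apply: ge0_le_intEFin.
  - apply: measurable_funM => //; apply: measurable_funM; first exact: mn.
    by apply: (measurableT_comp (mn _ fi)).
  - by apply: (measurableT_comp mP); exact: pair1_measurable.
  - move=> z; rewrite !mulr_ge0 ?normc_ge0// andTb PE.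
    rewrite [leRHS](_ : _ = (W z * W (y - z)) * (normc (fourier g z) * normc (fourier f (y - z)))); last by ring.
    rewrite ler_wpM2r ?mulr_ge0 ?normc_ge0//.
    by rewrite -{1}(subrK z y) addrC; exact: expR_weight_enormD.
rewrite (fubini_tonelli (fun p : V * V => (P p)%:E))//; last exact/measurable_EFinP.
have mN h : cintegrable mu h -> measurable_fun setT (fun y : V => (normc (fourier h y) * W y)%:E).
  by move=> hi; apply/measurable_EFinP; apply: measurable_funM => //; exact: mn.
under eq_integral => z _.
  under eq_integral do rewrite PE EFinM.
  rewrite ge0_integralZl//; last 3 first.
  - apply/measurable_EFinP.
    apply: (measurableT_comp (f := fun y : V => normc (fourier f y) * W y)).
      by apply: measurable_funM => //; exact: mn.
    exact: measurable_rV_addr.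
  - by move=> y _; rewrite lee_fin mulr_ge0 ?normc_ge0.
  - by rewrite lee_fin mulr_ge0 ?normc_ge0.
  rewrite (ge0_integral_translation (- z) (F := fun y : V => (normc (fourier f y) * W y)%:E))//; last 2 first.
  - exact: mN.
  - by move=> y; rewrite lee_fin mulr_ge0 ?normc_ge0.
  over.
rewrite ge0_integralZr//.
- exact: mN.
- by move=> y _; rewrite lee_fin mulr_ge0 ?normc_ge0.
- by apply: integral_ge0 => y _; rewrite lee_fin mulr_ge0 ?normc_ge0.
Qed.

End product_estimate.

(** * A gliding hump *)

Section gliding_hump.
Context {R : realType}.

(** The numbers p + q and p - q differ by 2 q, so that one of them has modulus
    at least that of q. *)
Lemma normc_max_sign (p q : R[i]) :
  exists2 s : R, `|s| = 1 & normc q <= normc (p + real_complex R s * q).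
Proof.
have [h|h] := leP (normc q) (normc (p + q)).
  by exists 1; rewrite ?normr1// rmorph1 mul1r.
exists (-1); first by rewrite normrN1.
rewrite rmorphN1 mulN1r.
have : normc ((p + q) - (p - q)) <= normc (p + q) + normc (p - q).
  by rewrite -(normcN (p - q)); exact: le_normcD.
have -> : p + q - (p - q) = real_complex R 2 * q.
  by rewrite (_ : 2 = 1 + 1)// rmorphD rmorph1; ring.
by rewrite normcM normc_real gtr0_norm//; lra.
Qed.

Let geom (n N : nat) : \sum_(n.+1 <= j < n.+1 + N) 4^-1 ^+ j <= 4^-1 ^+ n / 3 :> R.
Proof.
suff -> : \sum_(n.+1 <= j < n.+1 + N) (4^-1 : R) ^+ j =
    4^-1 ^+ n / 3 * (1 - 4^-1 ^+ N).
  have q0 k : 0 <= (4^-1 : R) ^+ k by rewrite exprn_ge0// invr_ge0.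
  apply: ler_piMr; last by rewrite gerBl.
  exact: divr_ge0.
elim: N => [|N IH]; first by rewrite addn0 big_geq// expr0 subrr mulr0.
rewrite addnS big_nat_recr ?leq_addr//= IH exprD !exprS; by field.
Qed.

(** Row n of t is the n-th functional evaluated on a sequence of vectors, with
    norm at most S n and nearly attained at the n-th vector.  The sign s n is
    chosen so that its term does not cancel the earlier ones, which leaves at
    least 4^-n S n / 2; the later terms contribute at most 4^-n S n / 3. *)
Lemma gliding_hump (t : nat -> nat -> R[i]) (S : nat -> R) :
  (forall n j, normc (t n j) <= S n) -> (forall n, S n / 2 <= normc (t n n)) ->
  exists s : nat -> R, (forall j, `|s j| = 1) /\
    forall n N, (n < N)%N -> 4^-1 ^+ n * (S n / 6) <=
      normc (\sum_(0 <= j < N) real_complex R (s j * 4^-1 ^+ j) * t n j).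
Proof.
move=> tS St.
have /choice[sg sgP] : forall pq : R[i] * R[i], exists s : R,
    `|s| = 1 /\ normc pq.2 <= normc (pq.1 + real_complex R s * pq.2).
  by case=> p q; have [s] := normc_max_sign p q; exists s.
pose psum (l : seq R) n := \sum_(0 <= j < n) real_complex R (nth 0 l j * 4^-1 ^+ j) * t n j.
(* The signs are built as a growing list, the next one depending on the
   partial sum in the row of its own index. *)
pose next (l : seq R) := rcons l (sg (psum l (size l), real_complex R (4^-1 ^+ (size l)) * t (size l) (size l))).
pose L n := iter n next [::].
have szL n : size (L n) = n by elim: n => //= n IH; rewrite size_rcons IH.
pose s n := nth 0 (L n.+1) n.
have Ls n m : (m < n)%N -> nth 0 (L n) m = s m.
  elim: n => // n IH; rewrite ltnS leq_eqVlt => /predU1P[->//|mn].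
  by rewrite /= nth_rcons szL mn IH.
have sE n : s n = sg (\sum_(0 <= j < n) real_complex R (s j * 4^-1 ^+ j) * t n j,
    real_complex R (4^-1 ^+ n) * t n n).
  rewrite /s /= nth_rcons szL ltnn eqxx; congr (sg (_, _)).
  by apply: eq_big_nat => j /andP[_ jn]; rewrite Ls.
have s1 j : `|s j| = 1 by rewrite sE; have [] := sgP (\sum_(0 <= i < j) real_complex R (s i * 4^-1 ^+ i) * t j i, real_complex R (4^-1 ^+ j) * t j j).
exists s; split => // n N nN.
have S0 : 0 <= S n.
  by apply: le_trans (tS n n); exact: normc_ge0.
have q0 j : 0 <= (4^-1 : R) ^+ j by rewrite exprn_ge0// invr_ge0.
rewrite (@big_cat_nat _ _ _ n.+1)//=.
set T1 := \sum_(0 <= j < n.+1) _; set T2 := \sum_(n.+1 <= j < N) _.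
have h1 : 4^-1 ^+ n * (S n / 2) <= normc T1.
  rewrite /T1 big_nat_recr//=.
  rewrite rmorphM -mulrA.
  have [_ /=] := sgP (\sum_(0 <= i < n) real_complex R (s i * 4^-1 ^+ i) * t n i,
    real_complex R (4^-1 ^+ n) * t n n).
  rewrite -sE; apply: le_trans.
  by rewrite normcM normc_real ger0_norm// ler_wpM2l.
have h2 : normc T2 <= 4^-1 ^+ n / 3 * S n.
  apply: (@le_trans _ _ (\sum_(n.+1 <= j < N) 4^-1 ^+ j * S n)).
    rewrite /T2; elim/big_ind2 : _ => //; first by rewrite normc0.
      by move=> z a w b za wb; rewrite (le_trans (le_normcD _ _))// lerD.
    move=> j _; rewrite normcM normc_real normrM s1 mul1r ger0_norm//.
    by rewrite ler_wpM2l.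
  by rewrite -mulr_suml ler_wpM2r// -(subnKC nN) geom.
have h3 : normc T1 <= normc (T1 + T2) + normc T2.
  by rewrite -[in leLHS](addrK T2 T1) (le_trans (le_normcD _ _))// normcN.
have : 4^-1 ^+ n * (S n / 6) = 4^-1 ^+ n * (S n / 2) - 4^-1 ^+ n / 3 * S n by field.
by move=> ->; lra.
Qed.

Lemma geometric_tail_le (N M : nat) : (N <= M)%N ->
  \sum_(N <= j < M) 4^-1 ^+ j <= 4 * 4^-1 ^+ N :> R.
Proof.
case: N => [|N] NM.
  case: M {NM} => [|M]; first by rewrite big_geq// mulr1.
  rewrite big_nat_recl//= expr0 mulr1; have := geom 0 M.
  rewrite add1n big_add1 /= expr0 => h; rewrite -[leRHS](_ : 1 + 3 = _); last by ring.
  by rewrite lerD2l (le_trans h)//; lra.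
rewrite -(subnKC NM); apply: (le_trans (geom _ _)).
by rewrite exprS; have : 0 <= (4^-1 : R) ^+ N; [rewrite exprn_ge0// invr_ge0|lra].
Qed.

Lemma geometric_series_lim (u : nat -> R) : (forall j, `|u j| <= 4^-1 ^+ j) ->
  exists l, forall N, `|l - \sum_(0 <= j < N) u j| <= 4 * 4^-1 ^+ N.
Proof.
move=> uq.
have cv : cvgn (series u).
  apply: (@normed_cvg _ R^o).
  apply: (series_le_cvg (v_ := geometric 1 4^-1)) => [j|j|j|].
  - exact: normr_ge0.
  - by rewrite /= mul1r exprn_ge0// invr_ge0.
  - by rewrite /= mul1r.
  - by apply: is_cvg_geometric_series; rewrite ger0_norm ?invr_ge0// invf_lt1 ?ltr1n.
exists (limn (series u)) => N.
have : series u M - \sum_(0 <= j < N) u j @[M --> \oo] -->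
    limn (series u) - \sum_(0 <= j < N) u j.
  by apply: cvgB => //; exact: cvg_cst.
move/cvg_norm/cvgr_to_le; apply; near=> M.
have NM : (N <= M)%N by near: M; exact: nbhs_infty_ge.
rewrite /series /= (@big_cat_nat _ _ _ N)//= addrAC subrr add0r.
rewrite (le_trans (ler_norm_sum _ _ _))//.
apply: (@le_trans _ _ (\sum_(N <= j < M) 4^-1 ^+ j)); first exact: ler_sum.
exact: geometric_tail_le.
Unshelve. all: by end_near. Qed.

End gliding_hump.

(** * Test functions *)

Section compact_support.
Context {R : realType} (n : nat).
Local Notation V := 'rV[R]_n.
Local Notation mu := (lebesgue_rV R n).

Lemma compact_rV_bounded (K : set V) : compact K ->
  exists2 B : R, 0 <= B & forall x : V, K x -> forall i, `|x ord0 i| <= B.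
Proof.
move=> cK.
have /compact_bounded[M [Mr KM]] := cK.
exists (`|M| + 1); first by rewrite addr_ge0.
move=> x Kx i; have h : `|x| <= `|M| + 1.
  by apply: KM Kx; rewrite (le_lt_trans (ler_norm _))// ltrDl.
apply: le_trans h; rewrite [leRHS]mx_normrE.
exact: (@le_bigmax _ _ _ _ (fun ij : 'I_1 * 'I_n => `|x ij.1 ij.2|) (ord0, i)).
Qed.

Lemma cintegrable_compact_support (f : V -> R[i]) (M : R) (K : set V) :
  cmeasurable f -> (forall x, normc (f x) <= M) -> compact K ->
  (forall x, ~ K x -> f x = 0) -> cintegrable mu f.
Proof.
move=> mf fM /compact_rV_bounded[B B0 KB] fK.
pose I : set R := `[- B, B]%classic.
pose A : set V := [set v | forall i, I (v ord0 i)].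
have mI : measurable I by exact: measurable_itv.
have mA : measurable A by exact: (measurable_rV_box (I := fun=> I)).
have muA : (mu A < +oo)%E.
  rewrite (lebesgue_rV_box (A := fun=> I))// (eq_bigr (fun=> (fine (lebesgue_measure I))%:E)).
    by rewrite prodEFin ltry.
  move=> i _; rewrite fineK// ge0_fin_numE// lebesgue_measure_itv /=.
  by case: ifP => _; rewrite ?ltry// -EFinB ltry.
have M0 : 0 <= M by rewrite (le_trans (normc_ge0 (f 0))).
apply: (@cintegrable_le _ _ _ _ _ (fun x => M * \1_A x)) => //.
- by apply: measurable_funM => //; exact: measurable_indic.
- under eq_integral do rewrite EFinM.
  rewrite ge0_integralZl//.
  + by rewrite integral_indic// setIT lte_mul_pinfty.
  + by apply/measurable_EFinP; exact: measurable_indic.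
- move=> x; have [Kx|Kx] := pselect (K x); last by rewrite fK// normc0 mulr_ge0.
  rewrite indicE mem_set ?mulr1// => i; rewrite /I /= in_itv /= -ler_norml.
  exact: KB.
Qed.

Lemma continuous_csupport_bounded (f : V -> R[i]) :
  continuous (f : V -> R[i]^o) -> compact (csupport f) ->
  exists M, forall x, normc (f x) <= M.
Proof.
move=> cf cK.
have cn : continuous (fun x : V => normc (f x)).
  move=> x; apply/(@cvgrPdist_lt _ _ _ (nbhs x) (nbhs_filter x) _ _) => e e0.
  have [r r0 xr] := continuous_complex_rV x cf e0.
  apply/nbhs_ballP; exists r => //= y [_ xy].
  have h : normc (f y - f x) < e.
    by apply: xr => i; rewrite distrC; exact: xy.
  have h1 : normc (f x) <= normc (f x - f y) + normc (f y).
    by rewrite -[in leLHS](subrK (f y) (f x)) normc_le_add.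
  have h2 : normc (f y) <= normc (f y - f x) + normc (f x).
    by rewrite -[in leLHS](subrK (f x) (f y)) normc_le_add.
  rewrite normc_subC in h1; rewrite ltr_norml; apply/andP; split; lra.
have := continuous_compact (continuous_subspaceT cn) cK.
move/compact_bounded => [M [Mr KM]].
exists (`|M| + 1) => x.
have [Kx|Kx] := pselect (csupport f x).
  rewrite -[leLHS]ger0_norm ?normc_ge0//; apply: KM => /=.
    by rewrite (le_lt_trans (ler_norm _))// ltrDl.
  by exists x.
have [->|fx] := eqVneq (f x) 0; first by rewrite normc0 addr_ge0.
by exfalso; apply: Kx; exact: subset_closure.
Qed.

Lemma csupport_eq0 (f : V -> R[i]) x : ~ csupport f x -> f x = 0.
Proof.
move=> Kx; have [//|fx] := eqVneq (f x) 0.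
by exfalso; apply: Kx; exact: subset_closure.
Qed.

Section test_functions.
Variables (Omega : set V) (om : R -> R) (f : V -> R[i]).
Hypothesis ft : test_fun Omega om f.

Lemma test_fun_bounded : exists M, forall x, normc (f x) <= M.
Proof. by case: ft => cf cK _ _; exact: continuous_csupport_bounded. Qed.

Lemma test_fun_cintegrable : cintegrable mu f.
Proof.
have [M fM] := test_fun_bounded; have [cf cK _ _] := ft.
apply: (cintegrable_compact_support _ fM cK); last exact: csupport_eq0.
exact: continuous_cmeasurable.
Qed.

Lemma test_fun_cintegrable_fourier : weight om -> cintegrable mu (fourier f).
Proof.
move=> omw; have [mf _] := test_fun_cintegrable; have [_ _ _ foo] := ft.
split; first exact: cmeasurable_fourier.
apply: le_lt_trans (foo 1 ltr01); apply: ge0_le_intEFin.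
- exact: measurable_normc_fourier.
- apply: measurable_funM; first exact: measurable_normc_fourier.
  exact: measurable_weight_enorm.
- move=> y; rewrite normc_ge0 ler_peMr ?normc_ge0//.
  by rewrite -[leLHS]expR0 ler_expR mul1r weight_enorm_ge0.
Qed.

End test_functions.

Lemma test_fun_mul_norm (Omega : set V) (om : R -> R) (l : R) (f g : V -> R[i]) :
  weight om -> 0 <= l -> test_fun Omega om f -> test_fun Omega om g ->
  test_fun Omega om (fun x => f x * g x) ->
  (((2 * pi) ^+ n)%:E * fourier_norm om l (fun x => f x * g x)%R <=
   fourier_norm om l g * fourier_norm om l f)%E.
Proof.
move=> omw l0 ft gt fgt; have [M gM] := test_fun_bounded gt.
apply: (fourier_norm_mul_le (M := M)) => //.
- exact: test_fun_cintegrable ft.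
- exact: test_fun_cintegrable gt.
- exact: test_fun_cintegrable fgt.
- by case: gt.
- exact: test_fun_cintegrable_fourier gt omw.
Qed.

End compact_support.

Section weight_growth.
Context {R : realType} (om : R -> R).
Hypothesis omw : weight om.

Lemma weight_ge_ln (q : R) :
  exists2 T : R, 0 < T & forall t, T <= t -> q * ln (1 + t) <= om t.
Proof.
have /cvgryPge/(_ q)[T [Tr qT]] := weight_log omw.
exists (`|T| + 1); first by rewrite ltr_wpDl.
move=> t Tt; have t0 : 0 < t by rewrite (lt_le_trans _ Tt)// ltr_wpDl.
have ln0 : 0 < ln (1 + t) by rewrite ln_gt0// ltrDl.
rewrite -ler_pdivlMr//; apply: qT.
by rewrite (lt_le_trans _ Tt)// (le_lt_trans (ler_norm _))// ltrDl.
Qed.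

(** Far out om dominates p log(1 + t); on the remaining bounded part the
    right-hand side is bounded below by 1 for C = (1 + T)^p. *)
Lemma expRN_weight_le (p : nat) :
  exists2 C : R, 0 < C & forall t, 0 <= t -> expR (- om t) <= C / (1 + t) ^+ p.
Proof.
have [T T0 omT] := weight_ge_ln p%:R.
have T1 : 1 <= 1 + T by rewrite lerDl ltW.
exists ((1 + T) ^+ p); first by rewrite exprn_gt0// (lt_le_trans ltr01).
move=> t t0; have t1 : 0 < 1 + t by rewrite ltr_pwDl.
have [Tt|tT] := leP T t.
  rewrite (@le_trans _ _ (1 / (1 + t) ^+ p))//.
    rewrite mul1r -[leRHS]lnK ?posrE ?invr_gt0 ?exprn_gt0// ler_expR.
    rewrite lnV ?posrE ?exprn_gt0// lerN2 lnXn// -mulr_natl.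
    exact: omT.
  by rewrite ler_wpM2r ?invr_ge0 ?exprn_ge0 ?(ltW t1)// exprn_ege1.
rewrite ler_pdivlMr ?exprn_gt0//.
rewrite (@le_trans _ _ (1 * (1 + t) ^+ p))//.
  rewrite ler_wpM2r ?exprn_ge0 ?(ltW t1)// expR_le1 oppr_le0.
  exact: weight_ge0 omw _ t0.
by rewrite mul1r lerXn2r ?nnegrE ?(ltW t1) ?(le_trans ler01)// lerD2l ltW.
Qed.

(** A decay of order 2 n in |y| splits into a quadratic decay in each of the n
    coordinates, which the product Poisson kernel of width 1 dominates. *)
Lemma expRN_weight_integrable (n : nat) :
  (\int[lebesgue_rV R n]_y (expR (- om (enorm y)))%:E < +oo)%E.
Proof.
have [C C0 omC] := expRN_weight_le (n * 2).
have mW : measurable_fun setT (fun y : 'rV[R]_n => expR (- om (enorm y))).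
  have := @measurable_weight_enorm _ n _ omw (-1).
  by under eq_fun do rewrite mulN1r.
apply: (@le_lt_trans _ _ (\int[lebesgue_rV R n]_y (C * poisson_rV 1 y)%:E)%E).
  apply: ge0_le_intEFin => //.
    by apply: measurable_funM => //; exact: measurable_poisson_rV.
  move=> y; rewrite expR_ge0/= (le_trans (omC _ (enorm_ge0 y)))//.
  rewrite ler_wpM2l ?(ltW C0)// mulnC exprM -exprVn -[X in _ ^+ X](card_ord n) -prodr_const.
  apply: ler_prod => i _.
  have e1 : 0 < 1 + enorm y by rewrite ltr_pwDl// enorm_ge0.
  have y2 : 0 < 1 ^+ 2 + y ord0 i ^+ 2 by rewrite ltr_pwDl ?exprn_gt0// sqr_ge0.
  rewrite invr_ge0 exprn_ge0 ?(ltW e1)//= /poisson mulr1.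
  rewrite (@le_trans _ _ (1 / (1 ^+ 2 + y ord0 i ^+ 2)))//; last first.
    by rewrite ler_wpM2r ?invr_ge0 ?(ltW y2)// ler1n.
  rewrite mul1r lef_pV2 ?posrE ?exprn_gt0// sqrrD expr1n -addrA lerD2l.
  rewrite -[leLHS]add0r lerD//; first by rewrite mulrn_wge0// mul1r enorm_ge0.
  rewrite -(real_normK (num_real (y ord0 i))) ler_pXn2r ?nnegrE ?enorm_ge0//.
  exact: coord_le_enorm.
under eq_integral do rewrite EFinM.
rewrite ge0_integralZl//.
- by rewrite integral_poisson_rV// -EFinM ltry.
- by apply/measurable_EFinP; exact: measurable_poisson_rV.
- by move=> y _; rewrite lee_fin poisson_rV_ge0.
- by rewrite lee_fin ltW.
Qed.

End weight_growth.

Section pairings.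
Context {R : realType} (n : nat).
Local Notation V := 'rV[R]_n.
Local Notation mu := (lebesgue_rV R n).

Lemma pairing_cint (Omega : set V) (h rho : V -> R[i]) :
  (forall x, ~ Omega x -> rho x = 0) ->
  pairing Omega h rho = cint mu (fun x => h x * rho x).
Proof.
move=> rO; rewrite /pairing /cintegral /cint; congr Complex;
  rewrite Rintegral_mkcond; apply: eq_Rintegral => x _; rewrite patchE;
  case: ifPn => //; rewrite notin_setE => Ox; rewrite rO// mulr0//.
Qed.

End pairings.

(** * Modulated series of test densities *)

Section modulated_series.
Context {R : realType} (n : nat).
Local Notation V := 'rV[R]_n.
Local Notation mu := (lebesgue_rV R n).

Lemma pow4_small (B e : R) : 0 < e -> exists N, B * 4^-1 ^+ N <= e.
Proof.
move=> e0.
have : geometric B (4^-1 : R) @ \oo --> 0.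
  by apply: cvg_geometric; rewrite ger0_norm ?invr_ge0// invf_lt1 ?ltr1n.
move/cvgrPdist_le => /(_ e e0)[N _ /(_ N (leqnn N))] /=.
rewrite sub0r normrN => h; exists N.
by rewrite (le_trans (ler_norm _)).
Qed.

(** The error bound is uniform in x: that is what permits integration term by
    term below.  Real and imaginary parts contribute 4 each to the constant. *)
Lemma modulated_sum (a : nat -> R) (xi : nat -> V) :
  (forall j, `|a j| <= 4^-1 ^+ j) ->
  exists m : V -> R[i], cmeasurable m /\ forall x N,
    normc (m x - \sum_(0 <= j < N) real_complex R (a j) * cis (- dotv x (xi j)))
      <= 8 * 4^-1 ^+ N.
Proof.
move=> aj.
have lim (tr : R -> R) : (forall t, `|tr t| <= 1) -> measurable_fun setT tr ->
    exists2 F : V -> R, measurable_fun setT F &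
    forall x N, `|F x - \sum_(0 <= j < N) a j * tr (- dotv x (xi j))| <= 4 * 4^-1 ^+ N.
  move=> tr1 mtr.
  have /choice[F FP] : forall x : V, exists l, forall N,
      `|l - \sum_(0 <= j < N) a j * tr (- dotv x (xi j))| <= 4 * 4^-1 ^+ N.
    move=> x; apply: geometric_series_lim => j; rewrite normrM.
    by rewrite (le_trans _ (aj j))// ler_piMr.
  exists F => //.
  apply: (measurable_fun_cvg (h := fun N x => \sum_(0 <= j < N) a j * tr (- dotv x (xi j)))).
    move=> N; apply: measurable_sum => j; apply: measurable_funM => //.
    apply: (measurableT_comp mtr); apply: measurable_funN.
    by apply: measurable_dotv => //; exact: measurable_cst.
  move=> x _; apply/cvgrPdist_le => e e0.
  have [N0 N0e] := pow4_small 4 e0; exists N0 => // N /= N0N.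
  rewrite (le_trans (FP x N))// (le_trans _ N0e)// ler_wpM2l//.
  by rewrite ler_wiXn2l// invf_le1 ?ler1n.
have [C mC CP] : exists2 F : V -> R, measurable_fun setT F &
    forall x N, `|F x - \sum_(0 <= j < N) a j * cos (- dotv x (xi j))| <= 4 * 4^-1 ^+ N.
  apply: lim; last by apply: continuous_measurable_fun; exact: continuous_cos.
  by move=> t; rewrite ler_norml cos_geN1 cos_le1.
have [D mD DP] : exists2 F : V -> R, measurable_fun setT F &
    forall x N, `|F x - \sum_(0 <= j < N) a j * sin (- dotv x (xi j))| <= 4 * 4^-1 ^+ N.
  apply: lim; last by apply: continuous_measurable_fun; exact: continuous_sin.
  by move=> t; rewrite ler_norml sin_geN1 sin_le1.
exists (fun x => Complex (C x) (D x)); split; first by split.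
move=> x N; rewrite (le_trans (normc_le_ReIm _))//.
set s := \sum_(0 <= j < N) _.
have [Rs Is] : complex.Re s = \sum_(0 <= j < N) a j * cos (- dotv x (xi j)) /\
    complex.Im s = \sum_(0 <= j < N) a j * sin (- dotv x (xi j)).
  rewrite /s; elim: (N) => [|N' [IHr IHi]]; first by rewrite !big_geq.
  rewrite !big_nat_recr//= Re_add Im_add IHr IHi Re_mul Im_mul /=.
  by rewrite !mul0r subr0 addr0.
rewrite -[X in X - s]/(Complex (C x) (D x)) Re_add Im_add.
have NE (z : R[i]) : complex.Re (- z) = - complex.Re z /\ complex.Im (- z) = - complex.Im z by case: z.
rewrite (NE s).1 (NE s).2 Rs Is /=.
rewrite (_ : 8 = 4 + 4); last by ring.
by rewrite mulrDl lerD.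
Qed.

Section approximation.
Variables (a : nat -> R) (xi : nat -> V) (m : V -> R[i]).
Hypothesis mm : cmeasurable m.
Hypothesis mP : forall x N,
    normc (m x - \sum_(0 <= j < N) real_complex R (a j) * cis (- dotv x (xi j)))
      <= 8 * 4^-1 ^+ N.

Lemma modulated_bound x : normc (m x) <= 8.
Proof. by have := mP x 0; rewrite big_geq// subr0 expr0 mulr1. Qed.

Lemma cintegrable_modulated (f : V -> R[i]) : cintegrable mu f ->
  cintegrable mu (fun x => f x * m x).
Proof.
move=> [mf foo]; apply: (@cintegrable_le _ _ _ _ _ (fun x => 8 * normc (f x))).
- exact: cmeasurableM.
- by apply: measurable_funM => //; exact: measurable_normc.
- under eq_integral do rewrite EFinM.
  rewrite ge0_integralZl//.
  + by rewrite lte_mul_pinfty.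
  + by apply/measurable_EFinP; exact: measurable_normc.
  + by move=> x _; rewrite lee_fin normc_ge0.
- by move=> x; rewrite normcM mulrC ler_wpM2r ?normc_ge0 ?modulated_bound.
Qed.

Lemma cint_modulated (f : V -> R[i]) N : cintegrable mu f ->
  normc (cint mu (fun x => f x * m x) -
    \sum_(0 <= j < N) real_complex R (a j) * fourier f (xi j)) <=
  8 * 4^-1 ^+ N * fine (\int[mu]_x (normc (f x))%:E)%E.
Proof.
move=> fi.
have fj j := cintegrable_fourier_integrand (xi j) fi.
have [iS <-] : cintegrable mu (fun x => \sum_(0 <= j < N) real_complex R (a j) * (f x * cis (- dotv x (xi j)))) /\
   cint mu (fun x => \sum_(0 <= j < N) real_complex R (a j) * (f x * cis (- dotv x (xi j)))) =
   \sum_(0 <= j < N) real_complex R (a j) * fourier f (xi j).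
  have [h1 h2] := cint_sum (index_iota 0 N) (fun j => cintegrableZ (real_complex R (a j)) (fj j)).
  by split=> //; rewrite h2; apply: eq_bigr => j _; rewrite cintZ// fourierE.
have im := cintegrable_modulated fi.
rewrite -cintN// -cintD//; last exact: cintegrableN.
have q0 : 0 <= (8 * 4^-1 ^+ N : R) by rewrite mulr_ge0// exprn_ge0// invr_ge0.
apply: normc_cint_le_bound; first by apply: cintegrableD => //; exact: cintegrableN.
have [mf foo] := fi.
rewrite EFinM fineK; last exact: (integrable_fin_num measurableT (cintegrable_normc fi)).
rewrite -ge0_integralZl//; last 2 first.
- by apply/measurable_EFinP; exact: measurable_normc.
- by move=> x _; rewrite lee_fin normc_ge0.
under [leRHS]eq_integral do rewrite -EFinM.
apply: ge0_le_intEFin.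
- apply: measurable_normc; apply: cmeasurableD; first by case: im.
  by apply: cmeasurableN; case: iS.
- by apply: measurable_funM => //; exact: measurable_normc.
- move=> x; rewrite normc_ge0/=.
  have -> : f x * m x - \sum_(0 <= j < N) real_complex R (a j) * (f x * cis (- dotv x (xi j))) =
     (m x - \sum_(0 <= j < N) real_complex R (a j) * cis (- dotv x (xi j))) * f x.
    rewrite mulrBl mulrC; congr (_ - _); rewrite mulr_suml.
    by apply: eq_bigr => j _; rewrite -mulrA; congr (_ * _); rewrite mulrC.
  by rewrite normcM ler_wpM2r ?normc_ge0.
Qed.

End approximation.
End modulated_series.

Section modulated_test_L2.
Context {R : realType} (n : nat).
Local Notation V := 'rV[R]_n.
Local Notation mu := (lebesgue_rV R n).
Variables (Omega : set V) (om : R -> R) (k : R) (psi : V -> R[i]).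
Hypotheses (omw : weight om) (k0 : 0 < k) (psit : test_fun Omega om psi).
Variables (a : nat -> R) (xi : nat -> V) (m : V -> R[i]).
Hypothesis aP : forall j, `|a j| <= 4^-1 ^+ j * expR (- (2 * k * om (enorm (xi j)))).
Hypothesis mm : cmeasurable m.
Hypothesis mP : forall x N,
    normc (m x - \sum_(0 <= j < N) real_complex R (a j) * cis (- dotv x (xi j)))
      <= 8 * 4^-1 ^+ N.

Let rho x := psi x * m x.
Let W (y : V) := expR (2 * k * om (enorm y)).
Let psii : cintegrable mu psi := test_fun_cintegrable psit.
Let rhoi : cintegrable mu rho := cintegrable_modulated mm mP psii.

Let W0 y : 0 < W y. Proof. exact: expR_gt0. Qed.

Let mW : measurable_fun setT W.
Proof. exact: measurable_weight_enorm. Qed.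

Let fourier_shift y z : fourier (fun x => psi x * cis (- dotv x y)) z = fourier psi (z + y).
Proof.
rewrite !fourierE; congr cint; apply/funext => x.
by rewrite -mulrA -cisD dotvDr opprD [- dotv x y + _]addrC.
Qed.

Let u j y := `|a j| * W (xi j) * (normc (fourier psi (y + xi j)) * W (y + xi j)).

Let u_ge0 j y : 0 <= u j y.
Proof. by rewrite /u !mulr_ge0 ?normc_ge0// ltW. Qed.

Let mu_fun j : measurable_fun setT (u j).
Proof.
apply: measurable_funM => //.
apply: (measurableT_comp (f := fun y : V => normc (fourier psi y) * W y)); last first.
  exact: measurable_rV_addr.
apply: measurable_funM => //; apply: measurable_normc_fourier.
by case: psii.
Qed.

Let fourier_rho_le y : ((normc (fourier rho y) * W y)%:E <= \sum_(j <oo) (u j y)%:E)%E.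
Proof.
apply/lee_addgt0Pr => e e0.
have fyi : cintegrable mu (fun x => psi x * cis (- dotv x y)).
  exact: cintegrable_fourier_integrand.
set B := fine (\int[mu]_x (normc (psi x * cis (- dotv x y)))%:E)%E.
have [N Ne] := pow4_small (8 * B * W y) e0.
apply: (@le_trans _ _ (\sum_(0 <= j < N) (u j y)%:E + e%:E)%E); last first.
  by apply: leeD2r; apply: nneseries_lim_ge => j _ _; rewrite lee_fin.
rewrite sumEFin -EFinD lee_fin.
have h := cint_modulated mm mP N fyi.
rewrite -/B in h.
have rE : fourier rho y = cint mu (fun x => psi x * cis (- dotv x y) * m x).
  by rewrite fourierE; congr cint; apply/funext => x; rewrite /rho mulrAC.
rewrite rE; set z := cint _ _; set s := \sum_(0 <= j < N) _ in h.
have zs : normc z <= normc (z - s) + normc s.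
  by rewrite -[in leLHS](subrK s z) normc_le_add.
apply: (@le_trans _ _ ((normc s + 8 * 4^-1 ^+ N * B) * W y)).
  by rewrite ler_wpM2r ?(ltW (W0 _))// (le_trans zs)// addrC lerD2l.
rewrite mulrDl lerD//; last first.
  by rewrite (le_trans _ Ne)// le_eqVlt; apply/orP; left; apply/eqP; ring.
rewrite -ler_pdivlMr// (le_trans (normc_sum _ _ _))// ler_pdivlMr// mulr_suml.
apply: ler_sum => j _; rewrite normcM normc_real fourier_shift [xi j + y]addrC /u.
rewrite -!mulrA ler_wpM2l// mulrCA ler_wpM2l ?normc_ge0//.
have := @expR_weight_enormD _ n _ omw (2 * k) (- xi j) (y + xi j).
rewrite enormN addrC addrK; apply; by rewrite mulr_ge0// ltW.
Qed.

Let sum_u_lty : (\sum_(j <oo) \int[mu]_y (u j y)%:E < +oo)%E.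
Proof.
have [_ _ _ foo] := psit.
have k2 : 0 < 2 * k by rewrite mulr_gt0.
pose P := fine (fourier_norm om (2 * k) psi).
have PE : fourier_norm om (2 * k) psi = P%:E.
  by rewrite fineK// ge0_fin_numE ?fourier_norm_ge0// foo.
have P0 : 0 <= P by rewrite fine_ge0// fourier_norm_ge0.
have uE j : (\int[mu]_y (u j y)%:E = (`|a j| * W (xi j) * P)%:E)%E.
  rewrite /u; under eq_integral do rewrite EFinM.
  have mN : measurable_fun setT (fun y : V => (normc (fourier psi y) * W y)%:E).
    apply/measurable_EFinP; apply: measurable_funM => //; apply: measurable_normc_fourier.
    by case: psii.
  have N0 y : (0 <= (normc (fourier psi y) * W y)%:E)%E.
    by rewrite lee_fin mulr_ge0 ?normc_ge0// ltW.
  rewrite ge0_integralZl//.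
  - rewrite (ge0_integral_translation (xi j) (F := fun y : V => (normc (fourier psi y) * W y)%:E))//.
    by rewrite -/(fourier_norm om (2 * k) psi) PE -EFinM.
  - apply: (measurableT_comp mN); exact: measurable_rV_addr.
  - by rewrite lee_fin mulr_ge0// ltW.
apply: (@le_lt_trans _ _ (4 * P)%:E); last exact: ltry.
apply: lime_le.
  by apply: is_cvg_nneseries => j _ _; rewrite uE lee_fin !mulr_ge0// ltW.
apply: nearW => N; under eq_bigr do rewrite uE.
rewrite sumEFin lee_fin -mulr_suml ler_wpM2r//.
apply: (@le_trans _ _ (\sum_(0 <= j < N) 4^-1 ^+ j)); last first.
  by have := @geometric_tail_le R 0 N (leq0n N); rewrite expr0 mulr1.
apply: ler_sum => j _; rewrite -ler_pdivlMr// /W -expRN; exact: aP.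
Qed.

Lemma fourier_norm_modulated_lty : (fourier_norm om (2 * k) rho < +oo)%E.
Proof.
apply: le_lt_trans sum_u_lty; rewrite -integral_nneseries//; last 2 first.
- by move=> j; exact/measurable_EFinP.
- by move=> j y _; rewrite lee_fin.
apply: ge0_le_integral => //.
- by move=> y _; rewrite lee_fin mulr_ge0 ?normc_ge0// ltW.
- apply/measurable_EFinP; apply: measurable_funM => //; apply: measurable_normc_fourier.
  by case: rhoi.
- apply: (@ge0_emeasurable_sum _ _ _ setT (fun j y => (u j y)%:E) xpredT).
  + by move=> j y _ _; rewrite lee_fin.
  + by move=> j _; exact/measurable_EFinP.
Qed.

(** The transform of psi m is dominated by the series of the |a j| times
    translates of the transform of psi; translating by xi j costs a factor
    exp(2 k om |xi j|), which the decay of a j absorbs.  So the weighted L^1 norm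
    is finite, and as the transform is bounded the weighted L^2 norm is too. *)
Lemma modulated_test_L2 : test_L2 Omega om k rho.
Proof.
have [psic psiK psiO _] := psit.
have [mrho rhooo] := rhoi.
have [M psiM] := test_fun_bounded psit.
have M0 : 0 <= M by rewrite (le_trans (normc_ge0 (psi 0))).
have rhoM x : normc (rho x) <= M * 8.
  by rewrite normcM ler_pM ?normc_ge0//; exact: (modulated_bound mP).
split.
- by case: mrho.
- by case: mrho.
- rewrite unlock /=; apply: poweR_lty.
  have pE x : (`|(EFin \o (@normc R \o rho)) x| `^ 2%:R = (normc (rho x) ^+ 2)%:E)%E.
    rewrite -[LHS]/(`|normc (rho x)|%:E `^ 2%:R)%E ger0_norm ?normc_ge0//.
    by rewrite poweR_EFin powR_mulrn ?normc_ge0.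
  rewrite (eq_integral (fun x => (normc (rho x) ^+ 2)%:E)); last by move=> x _; exact: pE.
  apply: (@le_lt_trans _ _ (\int[mu]_x (M * 8 * normc (rho x))%:E)%E).
    apply: ge0_le_intEFin.
    + by apply: measurable_funX; exact: measurable_normc.
    + by apply: measurable_funM => //; exact: measurable_normc.
    + by move=> x; rewrite exprn_ge0 ?normc_ge0//= expr2 ler_wpM2r ?normc_ge0.
  under eq_integral do rewrite EFinM.
  rewrite ge0_integralZl//.
  + by rewrite lte_mul_pinfty// lee_fin mulr_ge0.
  + by apply/measurable_EFinP; exact: measurable_normc.
  + by move=> x _; rewrite lee_fin normc_ge0.
  + by rewrite lee_fin mulr_ge0.
- exists (csupport psi); split=> //; apply: aeW => x Kx.
  by rewrite /rho csupport_eq0// mul0r.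
apply: poweR_lty.
pose A := fine (\int[mu]_x (normc (rho x))%:E)%E.
have A0 : 0 <= A by rewrite fine_ge0// integral_ge0// => x _; rewrite lee_fin normc_ge0.
have mn : measurable_fun setT (fun y => normc (fourier rho y)).
  exact: measurable_normc_fourier.
apply: (@le_lt_trans _ _ (\int[mu]_y (A * (normc (fourier rho y) * W y))%:E)%E).
  apply: ge0_le_intEFin.
  - by apply: measurable_funM => //; exact: measurable_funX.
  - by apply: measurable_funM => //; exact: measurable_funM.
  - move=> y; rewrite mulr_ge0 ?exprn_ge0 ?normc_ge0 ?(ltW (W0 _))//=.
    rewrite expr2 -mulrA; apply: ler_wpM2r; last exact: normc_fourier_le.
    by rewrite mulr_ge0 ?normc_ge0// ltW.
under eq_integral do rewrite EFinM.
rewrite ge0_integralZl//.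
- by rewrite lte_mul_pinfty// fourier_norm_modulated_lty.
- by apply/measurable_EFinP; exact: measurable_funM.
- by move=> y _; rewrite lee_fin mulr_ge0 ?normc_ge0// ltW.
Qed.

End modulated_test_L2.

(** * Uniform decay of the transforms *)

Section uniform_bound.
Context {R : realType} (n : nat).
Local Notation V := 'rV[R]_n.
Local Notation mu := (lebesgue_rV R n).
Variables (Omega : set V) (om : R -> R) (k : R) (psi : V -> R[i]) (h : R -> V -> R[i]).
Hypotheses (omw : weight om) (k0 : 0 < k) (psit : test_fun Omega om psi).
Hypothesis psih : forall e, 0 < e < 1 -> test_fun Omega om (fun x => psi x * h e x).
Hypothesis hnull : forall rho : V -> R[i], test_L2 Omega om k rho ->
  null_gen_number om (fun e => pairing Omega (h e) rho).

Let g e (x : V) := psi x * h e x.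
Let w (y : V) := expR (- (2 * k * om (enorm y))).

Let w_le1 y : w y <= 1.
Proof. by rewrite expR_le1 oppr_le0 !mulr_ge0 ?weight_enorm_ge0// ltW. Qed.

(** If no C works, then the suprema over y of
    |(psi h_e)^(y)| exp(L om (1/e)) exp(- 2 k om |y|) exceed 6 4^j at some e_j
    tending to 0, and a gliding hump through nearly maximal points y_j builds a
    density whose pairing with h_(e_j) has modulus at least 3/4 of
    exp(- L om (1/e_j)), while the hypothesis bounds it by half of that once j
    is large. *)
Lemma uniform_fourier_bound (L : R) : 0 < L -> exists2 C : R, 0 < C &
  \forall e \near 0^'+, forall y : V,
    normc (fourier (fun x => psi x * h e x) y) <=
    C * expR (- (L * om e^-1)) * expR (2 * k * om (enorm y)).
Proof.
move=> L0.
pose b e (y : V) := normc (fourier (g e) y) * expR (L * om e^-1) * w y.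
apply: contrapT => noC.
have /choice[en enP] : forall j : nat, exists e : R,
    [/\ 0 < e, e < j.+2%:R^-1 & exists y, 6 * 4 ^+ j < b e y].
  move=> j; apply: contrapT => noe; apply: noC.
  exists (6 * 4 ^+ j); first by rewrite mulr_gt0// exprn_gt0.
  near=> e => y.
  have e0 : 0 < e by near: e; exact: nbhs_right_gt.
  have ej : e < j.+2%:R^-1 by near: e; apply: nbhs_right_lt; rewrite invr_gt0.
  have : b e y <= 6 * 4 ^+ j.
    rewrite leNgt; apply/negP => bj; apply: noe; exists e; split => //; by exists y.
  have -> : normc (fourier (fun x => psi x * h e x) y) =
      b e y * expR (- (L * om e^-1)) * expR (2 * k * om (enorm y)).
    rewrite /b /w !expRN -/(g e); field.
    by rewrite !lt0r_neq0 ?expR_gt0.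
  by move=> bj; rewrite !ler_wpM2r ?expR_ge0.
have e01 j : 0 < en j < 1.
  have [e0 ej _] := enP j; rewrite e0 (lt_le_trans ej)//.
  by rewrite invf_le1 ?ler1n.
pose S j := sup (range (b (en j))).
have gt j : test_fun Omega om (g (en j)) by exact: psih.
have gi j : cintegrable mu (g (en j)) by exact: test_fun_cintegrable (gt j).
have hS j : has_sup (range (b (en j))).
  split; first by exists (b (en j) 0); exists 0.
  exists (fine (\int[mu]_x (normc (g (en j) x))%:E)%E * expR (L * om (en j)^-1)).
  move=> _ [y _ <-]; rewrite /b.
  rewrite -[leRHS]mulr1 ler_pM ?expR_ge0 ?mulr_ge0 ?normc_ge0 ?expR_ge0//.
  by rewrite ler_wpM2r ?expR_ge0// normc_fourier_le.
have bS j y : b (en j) y <= S j by apply: ub_le_sup; [case: (hS j)|exists y].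
have S6 j : 6 * 4 ^+ j < S j.
  by have [_ _ [y yb]] := enP j; exact: lt_le_trans yb (bS j y).
have S0 j : 0 < S j by apply: le_lt_trans (S6 j); rewrite mulr_ge0// exprn_ge0.
have /choice[xi xiP] : forall j : nat, exists y, S j / 2 <= b (en j) y.
  move=> j; have S2 : 0 < S j / 2 by rewrite divr_gt0.
  have [_ [y _ <-] by_] := sup_adherent S2 (hS j).
  exists y; rewrite (le_trans _ (ltW by_))// -/(S j); lra.
pose t i j := fourier (g (en i)) (xi j) * real_complex R (expR (L * om (en i)^-1) * w (xi j)).
have tE i j : normc (t i j) = b (en i) (xi j).
  by rewrite /t normcM normc_real ger0_norm ?mulr_ge0 ?expR_ge0// mulrA.
have [s [s1 sP]] := gliding_hump (t := t) (S := S)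
  (fun i j => eq_ind_r (fun z => z <= S i) (bS i (xi j)) (tE i j))
  (fun i => eq_ind_r (fun z => S i / 2 <= z) (xiP i) (tE i i)).
have q0 j : 0 <= (4^-1 : R) ^+ j by rewrite exprn_ge0// invr_ge0.
pose a j := s j * 4^-1 ^+ j * w (xi j).
have aE j : `|a j| = 4^-1 ^+ j * w (xi j).
  by rewrite /a !normrM s1 mul1r (ger0_norm (q0 j)) ger0_norm ?expR_ge0.
have aw j : `|a j| <= 4^-1 ^+ j * expR (- (2 * k * om (enorm (xi j)))) by rewrite aE.
have a4 j : `|a j| <= 4^-1 ^+ j by rewrite aE ler_piMr.
(* The density whose pairings are too large is psi m. *)
have [m [mm mP]] := modulated_sum xi a4.
pose rho x := psi x * m x.
have rhot : test_L2 Omega om k rho by exact: (modulated_test_L2 omw k0 psit aw mm mP).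
have rho0 x : ~ Omega x -> rho x = 0.
  move=> Ox; rewrite /rho csupport_eq0 ?mul0r// => Kx; apply: Ox.
  by have [_ _ + _] := psit; exact.
have half : 0 < (1 / 2 : R) by lra.
have /nbhs_ballP[r /= r0 rP] := hnull rhot L0 half.
pose i := Num.truncn r^-1.
have ir : i.+2%:R^-1 < r.
  rewrite -[r]invrK ltf_pV2 ?posrE ?invr_gt0//.
  by rewrite (lt_le_trans (truncnS_gt _))// ler_nat.
have [ei0 eir _] := enP i.
have bi : ball 0 r (en i) by rewrite /ball /= sub0r normrN gtr0_norm// (lt_trans eir).
have : (`|(normc (pairing Omega (h (en i)) rho))%:E| <=
    (1 / 2 * `|expR (- L * om (en i)^-1)|)%:E)%E := rP _ bi ei0.
rewrite gee0_abs ?lee_fin ?normc_ge0// (ger0_norm (expR_ge0 _)).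
rewrite (pairing_cint _ rho0) mulNr expRN.
set E := expR (L * om (en i)^-1) => PE.
have E0 : 0 < E by exact: expR_gt0.
rewrite (_ : (fun x => h (en i) x * rho x) = fun x => g (en i) x * m x) in PE; last first.
  by apply/funext => x; rewrite /rho /g; ring.
set P := cint mu _ in PE.
pose A := fine (\int[mu]_x (normc (g (en i) x))%:E)%E.
have [N NE] := pow4_small (8 * E * A) (ltac:(lra) : 0 < (1 / 4 : R)).
(* The partial sum must contain the term of index i and also approximate the
   pairing up to a quarter. *)
pose N' := (i.+1 + N)%N.
have A0 : 0 <= A by rewrite fine_ge0// integral_ge0// => x _; rewrite lee_fin normc_ge0.
have NE' : 8 * 4^-1 ^+ N' * A * E <= 1 / 4.
  apply: le_trans NE; rewrite (_ : 8 * 4^-1 ^+ N' * A * E = 8 * E * A * 4^-1 ^+ N'); last by ring.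
  rewrite ler_wpM2l ?mulr_ge0 ?(ltW E0)// ler_wiXn2l ?invr_ge0// ?invf_le1 ?ler1n//.
  exact: leq_addl.
have happ := cint_modulated mm mP N' (gi i).
rewrite -/P -/A in happ.
set s' := \sum_(0 <= j < N') _ in happ.
have sE : s' * real_complex R E = \sum_(0 <= j < N') real_complex R (s j * 4^-1 ^+ j) * t i j.
  rewrite mulr_suml; apply: eq_bigr => j _; rewrite /t /a -/E !rmorphM; ring.
have := sP i N' (leq_addr _ _); rewrite -sE normcM normc_real (gtr0_norm E0) => low.
have low1 : 1 <= normc s' * E.
  apply: le_trans low; rewrite exprVn mulrC ler_pdivlMr ?exprn_gt0// mul1r.
  rewrite ler_pdivlMr// mulrC; exact/ltW.
have hs : normc s' <= normc (P - s') + normc P.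
  rewrite normc_subC; rewrite -[in leLHS](subrK P s'); exact: normc_le_add.
have hP : normc P * E <= 1 / 2.
  by rewrite -ler_pdivlMr// mulrC.
have hs' : normc s' * E <= 8 * 4^-1 ^+ N' * A * E + normc P * E.
  by rewrite -mulrDl ler_wpM2r ?(ltW E0)// (le_trans hs)// lerD2r.
have := le_trans low1 hs'; lra.
Unshelve. all: by end_near. Qed.

End uniform_bound.

(** * Interpolation and conclusion *)

Section interpolation.
Context {R : realType} (n : nat).
Local Notation V := 'rV[R]_n.
Local Notation mu := (lebesgue_rV R n).

Lemma local_norm_ge0 (Omega K : set V) om l (f : V -> R[i]) :
  (0 <= local_norm Omega om K l f)%E.
Proof. by apply: le_ereal_inf_tmp => _ [psi _ <-]; exact: fourier_norm_ge0. Qed.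

Lemma local_norm_lt (Omega K : set V) om l (f : V -> R[i]) (z : \bar R) :
  (local_norm Omega om K l f < z)%E ->
  exists psi, [/\ test_fun Omega om psi, forall x, K x -> psi x = 1 &
    (fourier_norm om l (fun x => psi x * f x)%R < z)%E].
Proof. by move=> /ereal_inf_lt[_ [psi [psit psi1] <-] fz]; exists psi. Qed.

(** Let X and Y be the two terms of the right-hand factor.  Then
    X Y = a exp(2 k o) exp(l o)^2, so the square of the left-hand side is at most
    C b^2 X Y, and X Y <= (X + Y)^2.  The constant C + 1 dominates the square
    root of C. *)
Lemma interpolation_pointwise (a C b k l o : R) : 0 <= a -> 0 < C ->
  0 <= b -> a <= C * b ^+ 2 * expR (2 * k * o) ->
  a * expR (l * o) <= (C + 1) * b * (a * expR ((2 * k + 2 * l + 1) * o) + expR (- o)).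
Proof.
move=> a0 C0 b0 ab.
set X := a * expR ((2 * k + 2 * l + 1) * o); set Y := expR (- o).
have X0 : 0 <= X by rewrite mulr_ge0 ?expR_ge0.
have Y0 : 0 <= Y by exact: expR_ge0.
have D0 : 0 <= (C + 1) * b by rewrite mulr_ge0// addr_ge0// ltW.
rewrite -(@ler_pXn2r _ 2)// ?nnegrE ?mulr_ge0 ?addr_ge0 ?expR_ge0//.
  have XY : X * Y = a * expR (2 * k * o) * expR (l * o) ^+ 2.
    rewrite /X /Y expr2 -!mulrA -!expRD; congr (a * expR _); ring.
  apply: (@le_trans _ _ (((C + 1) * b) ^+ 2 * (X * Y))).
    rewrite XY; move: ab; set F := expR (2 * k * o); set E := expR (l * o) => ab.
    have F0 : 0 <= F by exact: expR_ge0.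
    apply: (@le_trans _ _ (C * b ^+ 2 * F * (a * E ^+ 2))).
      rewrite (_ : (a * E) ^+ 2 = a * (a * E ^+ 2)); last by ring.
      by rewrite ler_wpM2r// mulr_ge0// sqr_ge0.
    rewrite (_ : C * b ^+ 2 * F * (a * E ^+ 2) = C * (b ^+ 2 * (a * F * E ^+ 2))); last by ring.
    rewrite (_ : ((C + 1) * b) ^+ 2 * (a * F * E ^+ 2) =
      (C + 1) ^+ 2 * (b ^+ 2 * (a * F * E ^+ 2))); last by ring.
    apply: ler_wpM2r.
      by apply: mulr_ge0; rewrite ?sqr_ge0//; apply: mulr_ge0; rewrite ?sqr_ge0// mulr_ge0.
    have C20 := sqr_ge0 C.
    by rewrite sqrrD mulr1 expr1n mulr2n -addrA; lra.
  rewrite [leRHS]exprMn; apply: ler_wpM2l; [exact: sqr_ge0|nra].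
exact: ltW.
Qed.

Lemma interpolation (om : R -> R) (f : V -> R[i]) (C b k l : R) :
  weight om -> cintegrable mu f -> 0 < C -> 0 <= b ->
  (forall y, normc (fourier f y) <= C * b ^+ 2 * expR (2 * k * om (enorm y))) ->
  (fourier_norm om l f <= ((C + 1) * b)%:E *
    (fourier_norm om (2 * k + 2 * l + 1) f + \int[mu]_y (expR (- om (enorm y)))%:E))%E.
Proof.
move=> omw [mf _] C0 b0 fb.
have mn : measurable_fun setT (fun y => normc (fourier f y)).
  exact: measurable_normc_fourier.
have mW q := @measurable_weight_enorm _ n _ omw q.
have mWN : measurable_fun setT (fun y : V => expR (- om (enorm y))).
  by have := mW (-1); under eq_fun do rewrite mulN1r.
rewrite /fourier_norm -ge0_integralD//; last 3 first.
- by move=> y _; rewrite lee_fin mulr_ge0 ?normc_ge0 ?expR_ge0.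
- by apply/measurable_EFinP; exact: measurable_funM.
- exact/measurable_EFinP.
have D0 : 0 <= (C + 1) * b by rewrite mulr_ge0// addr_ge0// ltW.
under [X in (_ <= _ * X)%E]eq_integral do rewrite -EFinD.
rewrite -ge0_integralZl//; last 2 first.
- by apply/measurable_EFinP; apply: measurable_funD => //; exact: measurable_funM.
- by move=> y _; rewrite lee_fin addr_ge0 ?mulr_ge0 ?normc_ge0 ?expR_ge0.
under [X in (_ <= X)%E]eq_integral do rewrite -EFinM.
apply: ge0_le_intEFin.
- exact: measurable_funM.
- by apply: measurable_funM => //; apply: measurable_funD => //; exact: measurable_funM.
- move=> y; rewrite mulr_ge0 ?normc_ge0 ?expR_ge0//=.
  exact: (interpolation_pointwise _ (normc_ge0 _) C0 b0 (fb y)).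
Qed.

End interpolation.

Theorem theorem8p2 (R : realType) (d : nat) (Omega : set 'rV[R]_d)
    (Omega_open : open Omega) (om : R -> R) (om_weight : weight om)
    (h : R -> 'rV[R]_d -> R[i]) (h_moderate : moderate Omega om h) :
  (exists2 k : R, 0 < k &
     forall rho : 'rV[R]_d -> R[i], test_L2 Omega om k rho ->
       null_gen_number om (fun e => pairing Omega (h e) rho)) ->
  eq_gen_fun Omega om h (fun _ _ => 0).
Proof.
move=> [k k0 hnull]; have [hnet hmod] := h_moderate.
rewrite /eq_gen_fun (_ : (fun e x => h e x - 0) = h); last first.
  by apply/funext => e; apply/funext => x; rewrite subr0.
split=> // K cK KO l l0 k' k'0 c c0.
have [psi psit psi1] : exists2 psi, test_fun Omega om psi & forall x, K x -> psi x = 1.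
  have [k1 _ hK] := hmod K cK KO l l0.
  have [e he] := @filter_ex _ _ (at_right_proper_filter 0) _ (hK 1 ltr01).
  have hoo : (local_norm Omega om K l (h e) < +oo)%E.
    by rewrite -[X in (X < _)%E]gee0_abs ?local_norm_ge0// (le_lt_trans he)// ltry.
  by have [psi [psit psi1 _]] := local_norm_lt hoo; exists psi.
have psih e : 0 < e < 1 -> test_fun Omega om (fun x => psi x * h e x).
  by move=> /hnet[_ _ psihE]; exact: psihE psit.
have [_ cK1 K1O psinorm] := psit.
pose m := 2 * k + 2 * l + 1.
have m0 : 0 < m by rewrite /m !addr_gt0// mulr_gt0.
have [N N0 hN] := hmod _ cK1 K1O m m0.
(* Interpolation halves the exponent 2 L; then exp(- L om) beats exp(N om)
   with k' to spare, plus 1 to absorb the constants. *)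
pose L := N + k' + 1.
have L0 : 0 < 2 * L by rewrite /L mulr_gt0// !addr_gt0.
have [C C0 hC] := uniform_fourier_bound om_weight k0 psit psih hnull L0.
pose P := fine (fourier_norm om m psi).
have PE : fourier_norm om m psi = P%:E.
  by rewrite fineK// ge0_fin_numE ?fourier_norm_ge0// psinorm.
have P0 : 0 <= P by rewrite fine_ge0// fourier_norm_ge0.
pose J := fine (\int[lebesgue_rV R d]_y (expR (- om (enorm y)))%:E)%E.
have J0' : (0 <= \int[lebesgue_rV R d]_y (expR (- om (enorm y)))%:E)%E.
  by apply: integral_ge0 => y _; rewrite lee_fin expR_ge0.
have JE : (\int[lebesgue_rV R d]_y (expR (- om (enorm y)))%:E = J%:E)%E.
  by rewrite fineK// ge0_fin_numE// expRN_weight_integrable.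
have J0 : 0 <= J by rewrite fine_ge0.
pose cd : R := (2 * pi) ^+ d.
have cd0 : 0 < cd by rewrite exprn_gt0// mulr_gt0// pi_gt0.
have [C1 C10 omC1] := expRN_weight_le om_weight 1.
pose Q := (C + 1) * (2 * P / cd + J).
have Q0 : 0 <= Q.
  by rewrite mulr_ge0 ?addr_ge0// ?(ltW C0)// divr_ge0 ?mulr_ge0// ltW.
(* Below r the bound exp(- om (1/e)) <= C1 e makes Q exp(- om (1/e)) at most c. *)
pose r := c / (Q * C1 + 1).
have QC : 0 < Q * C1 + 1 by rewrite ltr_wpDl// mulr_ge0// ltW.
have r0 : 0 < r by rewrite divr_gt0.
near=> e.
have e0 : 0 < e by near: e; exact: nbhs_right_gt.
have e1 : e < 1 by near: e; exact: nbhs_right_lt.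
have er : e < r by near: e; exact: nbhs_right_lt.
have eC : forall y : 'rV[R]_d, normc (fourier (fun x => psi x * h e x) y) <=
    C * expR (- (2 * L * om e^-1)) * expR (2 * k * om (enorm y)).
  by near: e; exact: hC.
have eN : (`|local_norm Omega om (csupport psi) m (h e)| <=
    (1 * `|expR (N * om e^-1)|)%:E)%E by near: e; exact: hN.
have e01 : 0 < e < 1 by rewrite e0.
set O := om e^-1.
have O0 : 0 <= O by apply: (weight_ge0 om_weight); rewrite invr_ge0 ltW.
pose G (x : 'rV[R]_d) := psi x * h e x.
have Gt : test_fun Omega om G by exact: psih.
have [pe [pet pe1 pem]] : exists pe, [/\ test_fun Omega om pe,
    forall x, csupport psi x -> pe x = 1 &
    (fourier_norm om m (fun x => pe x * h e x)%R < (2 * expR (N * O))%:E)%E].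
  apply: local_norm_lt; rewrite -[X in (X < _)%E]gee0_abs ?local_norm_ge0//.
  rewrite (le_lt_trans eN)// lte_fin ger0_norm ?expR_ge0// ltr_pM2r ?expR_gt0//.
  by rewrite ltr1n.
have gt : test_fun Omega om (fun x => pe x * h e x).
  by have [_ _ peh] := hnet _ e01; exact: peh pet.
have GE : G = fun x => psi x * (pe x * h e x).
  apply/funext => x; have [Kx|Kx] := pselect (csupport psi x).
    by rewrite pe1// mul1r.
  by rewrite /G csupport_eq0// !mul0r.
have Gm : (fourier_norm om m G <= (2 * P / cd * expR (N * O))%:E)%E.
  have := test_fun_mul_norm om_weight (ltW m0) psit gt _.
  rewrite -GE PE => /(_ Gt) hG.
  have : (cd%:E * fourier_norm om m G <= (2 * expR (N * O))%:E * P%:E)%E.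
    apply: (le_trans hG); apply: lee_wpmul2r; [by rewrite lee_fin|exact: ltW].
  rewrite -lee_pdivlMl// => /le_trans; apply.
  by rewrite -EFinM lee_fin le_eqVlt; apply/orP; left; apply/eqP; ring.
have Gl : (local_norm Omega om K l (h e) <= fourier_norm om l G)%E.
  by apply: ereal_inf_lbound; exists psi.
have eb : expR (- (2 * L * O)) = expR (- (L * O)) ^+ 2.
  by rewrite expr2 -expRD; congr expR; ring.
have Gb : (fourier_norm om l G <=
    ((C + 1) * expR (- (L * O)))%:E * (fourier_norm om m G + J%:E))%E.
  rewrite -JE; apply: interpolation => //; first exact: test_fun_cintegrable Gt.
  by move=> y; rewrite -eb; exact: eC.
rewrite gee0_abs ?local_norm_ge0// ger0_norm ?expR_ge0//.
apply: (le_trans Gl); apply: (le_trans Gb).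
apply: (@le_trans _ _ (((C + 1) * expR (- (L * O)))%:E *
    ((2 * P / cd + J) * expR (N * O))%:E)%E).
  apply: lee_wpmul2l; first by rewrite lee_fin mulr_ge0 ?expR_ge0// addr_ge0// ltW.
  rewrite mulrDl EFinD; apply: leeD => //; rewrite lee_fin ler_peMr//.
  by rewrite -expR0 ler_expR mulr_ge0// ltW.
rewrite -EFinM lee_fin.
have -> : (C + 1) * expR (- (L * O)) * ((2 * P / cd + J) * expR (N * O)) =
    Q * expR (- O) * expR (- k' * O).
  rewrite /Q (_ : - (L * O) = - (N * O) + - O + - k' * O); last by rewrite /L; ring.
  rewrite !expRD [expR (- (N * O))]expRN; field.
  by rewrite (lt0r_neq0 cd0) lt0r_neq0// expR_gt0.
rewrite ler_wpM2r ?expR_ge0//.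
have Oe : expR (- O) <= C1 * e.
  have := omC1 e^-1; rewrite invr_ge0 => /(_ (ltW e0)) /le_trans; apply.
  rewrite expr1 ler_wpM2l ?(ltW C10)// -[leRHS]invrK lef_pV2 ?posrE ?invr_gt0//.
    by rewrite lerDr.
  by rewrite ltr_pwDl// invr_ge0 ltW.
apply: (@le_trans _ _ (Q * (C1 * e))); first by rewrite ler_wpM2l.
rewrite mulrA (@le_trans _ _ ((Q * C1 + 1) * e))//.
  by rewrite ler_wpM2r ?(ltW e0)// lerDl.
by rewrite mulrC -ler_pdivlMr// ltW.
Unshelve. all: by end_near. Qed.
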